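(* Let $T$ be a caterpillar. Then $\gamma_{\rm SMB}'(T)=\infty$ if $\mathcal{P}_{\rm co}(T)=\emptyset$, and $\gamma_{\rm SMB}'(T)=\lceil\log_2 p(T)\rceil$ otherwise. Moreover, $\gamma_{\rm SMB}(T)=\infty$ if $t_{\rm p}(\mathcal{P}_{\rm co}(T))\le1$, and $\gamma_{\rm SMB}(T)=\lceil\log_2 p^*(T)\rceil$ otherwise.
   Context: The Maker-Breaker domination game on a finite simple graph $G$: Dominator and Staller alternately claim previously unclaimed vertices. Staller wins if she claims all vertices of the closed neighborhood $N_G[v]$ of some vertex $v$; otherwise Dominator wins. In the S-game Staller moves first, in the D-game Dominator moves first. $\gamma_{\rm SMB}'(G)$ (resp. $\gamma_{\rm SMB}(G)$) is the minimum number of moves Staller needs to win the S-game (resp. D-game) under optimal play (Staller minimizing the number of her moves, Dominator trying to prevent or delay her win), $\infty$ if Staller has no winning strategy. A caterpillar is a tree on at least three vertices in which a single path is incident to or contains every edge. For a caterpillar $T$: $\mathcal{P}_{\rm o}(T)$ is the set of paths $P$ in $T$ that are maximal with respect to inclusion and have an odd number of vertices. A path $P=u_1u_2\dots u_k$ in $T$ is clean if $\deg_T(u_i)=2$ for all $3\le i\le k-2$. $\mathcal{P}_{\rm co}(T)$ is the set of clean paths in $\mathcal{P}_{\rm o}(T)$. For a collection $\mathcal{P}$ of paths of $T$, $t_{\rm p}(\mathcal{P})$ is the smallest cardinality of a vertex set $U$ such that every path in $\mathcal{P}$ has a vertex in $U$ (so $t_{\rm p}(\emptyset)=0$). When $\mathcal{P}_{\rm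 co}(T)\neq\emptyset$, $p(T)$ is the minimum number of vertices of a path in $\mathcal{P}_{\rm co}(T)$. When $t_{\rm p}(\mathcal{P}_{\rm co}(T))\ge2$, $p^*(T)=\min\{s: t_{\rm p}(\{P\in\mathcal{P}_{\rm co}(T): |V(P)|\le s\})\ge2\}$. *)

(* Defs.v *)
From mathcomp Require Import all_boot.

Set Implicit Arguments.
Unset Strict Implicit.
Unset Printing Implicit Defensive.

(* A graph on the vertex set T is given by its adjacency relation e; simple
   means symmetric and irreflexive. *)
Definition simple_graph (T : finType) (e : rel T) : Prop :=
  symmetric e /\ irreflexive e.

Section Graphs.

Variables (T : finType) (e : rel T).

Definition closed_nbh (v : T) : {set T} := [set u | (u == v) || e v u].

Definition deg (v : T) : nat := #|[set u | e v u]|.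

Definition is_tree : Prop :=
  [/\ 0 < #|T|,
      forall x y, connect e x y
    & forall c : seq T, ucycle e c -> size c <= 2].

(* Paths are vertex sequences, so a path and its reversal are two codes of the
   same path.  The bound #|T| loses nothing, since the vertices are distinct. *)
Definition vseq := {bseq #|T| of T}.

Definition paths : {set vseq} :=
  [set P : vseq | [&& P != [::] :> seq T, sorted e P & uniq P]].

Definition path_edges (P : vseq) : seq {set T} :=
  [seq [set q.1; q.2] | q <- zip P (behead P)].

Definition subpath (P Q : vseq) : bool :=
  all (mem Q) P && all (mem (path_edges Q)) (path_edges P).

Definition maximal_path (P : vseq) : bool :=
  (P \in paths) && [forall Q in paths, subpath P Q ==> subpath Q P].

Definition is_caterpillar : Prop :=
  [/\ is_tree, 3 <= #|T|
    & exists2 P, P \in paths &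
        forall x y, e x y ->
          [\/ x \in P, y \in P | [set x; y] \in path_edges P]].

(* The path is u_1 ... u_k with k = size P, and u_i has index i - 1 in P. *)
Definition clean (P : vseq) : bool :=
  [forall j : 'I_(size P),
     (3 <= j.+1 <= size P - 2) ==> (deg (tnth (in_tuple P) j) == 2)].

Definition odd_maximal_paths : {set vseq} :=
  [set P | maximal_path P & odd (size P)].

Definition clean_odd_maximal_paths : {set vseq} :=
  [set P in odd_maximal_paths | clean P].

Definition transversal_of (PP : {set vseq}) (U : {set T}) : bool :=
  [forall P in PP, has (mem U) P].

(* The whole vertex set is a transversal of any collection of paths, so the
   default value #|T| is harmless. *)
Definition t_p (PP : {set vseq}) : nat :=
  \big[minn/#|T|]_(U : {set T} | transversal_of PP U) #|U|.

(* Meaningful when clean_odd_maximal_paths is nonempty. *)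
Definition p_min : nat :=
  \big[minn/#|T|]_(P in clean_odd_maximal_paths) size P.

(* Meaningful when 2 <= t_p clean_odd_maximal_paths; then s = #|T| qualifies. *)
Definition p_star : nat :=
  \big[minn/#|T|]_(s < #|T|.+1 |
      2 <= t_p [set P in clean_odd_maximal_paths | size P <= s]) s.

End Graphs.

(* In a position (D, S), D and S are the sets of vertices claimed so far by
   Dominator and by Staller. *)
Section Game.

Variables (T : finType) (e : rel T).

Definition free (D S : {set T}) : {set T} := ~: (D :|: S).

Definition staller_won (S : {set T}) : bool :=
  [exists v, closed_nbh e v \subset S].

(* Dominator is to move, and win D' tells whether Staller, then to move, can
   force a win once Dominator's set has become D'.  If Staller has not won and
   no vertex is left, Dominator has won. *)
Definition dominator_turn (win : {set T} -> bool) (D S : {set T}) : bool :=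
  staller_won S ||
  ((free D S != set0) && [forall y in free D S, win (y |: D)]).

(* Staller, to move in (D, S), can force a win by making at most n more moves. *)
Fixpoint staller_forces (n : nat) (D S : {set T}) : bool :=
  staller_won S ||
  (if n is n'.+1 then
     [exists x in free D S,
        dominator_turn (fun D' => staller_forces n' D' (x |: S)) D (x |: S)]
   else false).

(* Least n satisfying win, None standing for infinity; Staller never makes more
   than #|T| moves. *)
Definition min_moves (win : pred nat) : option nat :=
  if [exists n : 'I_#|T|.+1, win n]
  then Some (\big[minn/#|T|]_(n < #|T|.+1 | win n) n)
  else None.

Definition gamma_SMB' : option nat :=
  min_moves (fun n => staller_forces n set0 set0).

Definition gamma_SMB : option nat :=
  min_moves
    (fun n => dominator_turn (fun D => staller_forces n D set0) set0 set0).

End Game.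

(* Main.v *)
Require Import Defs.
From mathcomp Require Import all_boot zify.

Set Implicit Arguments.
Unset Strict Implicit.
Unset Printing Implicit Defensive.

(* Staller wins on a clean odd maximal path u_1 ... u_k by claiming an even
   vertex near the middle: she then needs only one of the two halves, and
   Dominator can spoil only one of them.  This takes ceil(log_2 k) moves.

   For Dominator, look at the support vertices along the spine of the
   caterpillar.  Two consecutive ones at odd distance have an even number of
   vertices between them, which can be matched so that every closed
   neighborhood centered there contains a matched pair; a support vertex is
   matched with its leaf, and Dominator answers in the same pair.  Between
   support vertices at even distance lies a gap with one vertex too many, which
   corresponds to a clean odd path.  When Staller plays in a gap, either one
   answer lets Dominator match the rest of it, or the gap falls into two gaps
   and Dominator matches the shorter one; the longer one then has more than half
   the size.  So n moves of Staller do not suffice while all gaps have weight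
   (number of vertices of the clean odd path) more than 2 ^ n.  In the D-game
   Dominator's first move at a support vertex disposes of all short gaps there. *)

(** * Pairs, gaps and Dominator's answer to a single move *)

Section Pairing.

Variable T : eqType.
Implicit Types (A q : pred T) (l r o : option T) (s : seq T).
Implicit Types (p : T * T) (P : seq (T * T)).

(* [None] stands for a vertex already claimed by Staller. *)
Definition in_opt A o := if o is Some z then A z else true.

(* [A] contains three consecutive entries of [l :: s ++ [:: r]] whose middle one
   satisfies [q]. *)
Fixpoint triple q l s r A : bool :=
  if s is c :: s' then
    (q c && [&& in_opt A l, A c & in_opt A (head r (map Some s'))])
    || triple q (Some c) s' r A
  else false.

Lemma triple_cat q l s1 s2 r A :
  triple q l (s1 ++ s2) r A =
  triple q l s1 (head r (map Some s2)) A
  || triple q (last l (map Some s1)) s2 r A.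
Proof.
elim: s1 l => [|c s1 IHs] l //=.
rewrite IHs orbA map_cat; congr (_ && [&& _, _ & _] || _ || _).
by case: s1 {IHs}.
Qed.

Lemma triple_ends q l l' s r r' A :
  (in_opt A l -> in_opt A l') -> (in_opt A r -> in_opt A r') ->
  triple q l s r A -> triple q l' s r' A.
Proof.
move=> + hr; elim: s l l' => [|c s IHs] l l' hl //= /orP[|/IHs].
  case/and4P=> -> /hl -> -> /= h; apply/orP; left.
  by case: s h {IHs}.
by move=> -> //; rewrite orbT.
Qed.

Fixpoint pairs s := if s is a :: b :: s' then (a, b) :: pairs s' else [::].

(** [A] will be a closed neighborhood: if it contains a pair, answering inside that pair gives
    Dominator a vertex of it. *)
Definition pair_cov P A := has (fun p => A p.1 && A p.2) P.

Lemma pair_cov_cat P1 P2 A :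
  pair_cov (P1 ++ P2) A = pair_cov P1 A || pair_cov P2 A.
Proof. exact: has_cat. Qed.

(** The partner of the middle vertex is one of its two neighbors in the triple; even length leaves
    no vertex unpaired. *)
Lemma triple_pairs q l s r A :
  ~~ odd (size s) -> triple q l s r A -> pair_cov (pairs s) A.
Proof.
have [n] := ubnP (size s); elim: n l s => // n IHn l [|a [|b s]] //= ltn.
rewrite negbK => ev /or3P[/and4P[_ _ -> ->] // | /and4P[_ -> -> _] // | tr].
by apply/orP; right; apply: IHn tr => //; lia.
Qed.

Definition pair_verts P := flatten [seq [:: p.1; p.2] | p <- P].

Lemma count_pair_verts_cat z P1 P2 :
  count_mem z (pair_verts (P1 ++ P2)) =
  count_mem z (pair_verts P1) + count_mem z (pair_verts P2).
Proof. by rewrite /pair_verts map_cat flatten_cat count_cat. Qed.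

Lemma count_pair_verts_cons z p P :
  count_mem z (pair_verts (p :: P)) =
  (p.1 == z) + (p.2 == z) + count_mem z (pair_verts P).
Proof. by rewrite /= addnA. Qed.

Lemma count_pairs z s : count_mem z (pair_verts (pairs s)) <= count_mem z s.
Proof.
have [n] := ubnP (size s); elim: n s => // n IHn [|a [|b s]] //= ltn.
by rewrite !leq_add2l; apply: IHn (ltnW ltn).
Qed.

(* The inner vertices of a gap, with the matched pairs (support vertex, leaf)
   that bound it; [None] is an end already claimed by Staller. *)
Local Notation gap := (option (T * T) * seq T * option (T * T))%type.
Implicit Types (g : gap) (G : seq gap).

Definition gap_cov g A :=
  triple predT (omap fst g.1.1) g.1.2 (omap fst g.2) A.

Definition cov P G A := pair_cov P A || has (gap_cov^~ A) G.

Definition gap_verts G := flatten [seq g.1.2 | g : gap <- G].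

Lemma count_gap_verts_cat z G1 G2 :
  count_mem z (gap_verts (G1 ++ G2)) =
  count_mem z (gap_verts G1) + count_mem z (gap_verts G2).
Proof. by rewrite /gap_verts map_cat flatten_cat count_cat. Qed.

Lemma count_gap_verts_cons z g G :
  count_mem z (gap_verts (g :: G)) =
  count_mem z g.1.2 + count_mem z (gap_verts G).
Proof. exact: count_cat. Qed.

Lemma count_gap_verts1 z g :
  count_mem z (gap_verts [:: g]) = count_mem z g.1.2.
Proof. by rewrite count_gap_verts_cons addn0. Qed.

(** The pairs bounding a gap are not listed again, since [gap_ok] places them in [P]. *)
Definition verts P G := pair_verts P ++ gap_verts G.

Lemma count_verts z P G :
  count_mem z (verts P G) =
  count_mem z (pair_verts P) + count_mem z (gap_verts G).
Proof. exact: count_cat. Qed.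

(** An end that is still a pair counts for two, its support vertex and its leaf. With both ends
    present this is the number of vertices of the corresponding clean odd path. *)
Definition weight g := size g.1.2 + (isSome g.1.1).*2 + (isSome g.2).*2.

(** The last condition prevents one pair from bounding the gap on both sides; losing a pair then
    costs at most one end. *)
Definition gap_ok N P g :=
  [&& odd (size g.1.2), 2 ^ N < weight g,
      (if g.1.1 is Some p then p \in P else true),
      (if g.2 is Some p then p \in P else true)
    & (g.1.1 == g.2) ==> (g.2 == None)].

Lemma gap_ok_mono N N' P P' g :
  N' <= N -> {subset P <= P'} -> gap_ok N P g -> gap_ok N' P' g.
Proof.
move=> leN sP /and5P[h1 h2 h3 h4 h5]; apply/and5P; split=> //.
- by apply: leq_ltn_trans h2; rewrite leq_exp2l.
- by case: g.1.1 h3 => // p /sP.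
- by case: g.2 h4 => // p /sP.
Qed.

(** When the pair [p] is used up, the end it provides is treated as claimed by Staller. This is
    pessimistic if Dominator owns the support vertex, but safe. *)
Definition drop_end p (o : option (T * T)) := if o == Some p then None else o.

Definition gap_drop p g : gap := (drop_end p g.1.1, g.1.2, drop_end p g.2).

Lemma gap_drop_cov p g A : gap_cov g A -> gap_cov (gap_drop p g) A.
Proof.
by apply: triple_ends; rewrite /= /drop_end; case: ifP.
Qed.

(** At most one end is lost, so the weight falls by at most 2, and [2 ^ N.+1 - 2 >= 2 ^ N] because
    [0 < N]. *)
Lemma gap_drop_ok N P1 P2 p g : 0 < N ->
  gap_ok N.+1 (P1 ++ p :: P2) g -> gap_ok N (P1 ++ P2) (gap_drop p g).
Proof.
case: g => [[lo s] hi] N0 /and5P[/= h1 h2 h3 h4 h5].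
have mem2 t : t \in P1 ++ p :: P2 -> t != p -> t \in P1 ++ P2.
  by rewrite !mem_cat inE => /or3P[-> //|/eqP->|->]; rewrite ?eqxx ?orbT.
have e2 : 2 <= 2 ^ N by rewrite -{1}[2]expn1 leq_exp2l.
rewrite /gap_ok /gap_drop /= h1 /=; apply/and4P; split.
- move: h2 h5; rewrite /weight /drop_end /= expnS.
  have [->|_] := eqVneq lo (Some p).
    rewrite [Some p == _]eq_sym; have [->//|_ /=] := eqVneq hi (Some p).
    by case: hi {h4} => [?|] /=; lia.
  by case: ifP => _ /=; case: (lo) => [?|]; case: (hi) => [?|] /=; lia.
- rewrite /drop_end; case: eqP => //; case: lo h3 {h2 h5} => // r rP nr.
  by apply: mem2 => //; apply/eqP=> E; case: nr; rewrite E.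
- rewrite /drop_end; case: eqP => //; case: hi h4 {h2 h5} => // r rP nr.
  by apply: mem2 => //; apply/eqP=> E; case: nr; rewrite E.
- rewrite /drop_end; case: ifP => [_|nlo]; case: ifP => [_|nhi] //; last first.
    by case: (lo).
  by rewrite eq_sym; apply/implyP.
Qed.

Lemma pair_cov_rem P1 p P2 A :
  pair_cov (P1 ++ p :: P2) A -> (A p.1 && A p.2) || pair_cov (P1 ++ P2) A.
Proof. by rewrite !pair_cov_cat /= => /or3P[->|->|->]; rewrite ?orbT. Qed.

Lemma gap_verts_drop p G :
  gap_verts [seq gap_drop p g | g <- G] = gap_verts G.
Proof. by rewrite /gap_verts -map_comp. Qed.

Lemma has_gap_drop p G A :
  has (gap_cov^~ A) G -> has (gap_cov^~ A) [seq gap_drop p g | g <- G].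
Proof.
by rewrite has_map; apply: sub_has => g /=; apply: gap_drop_cov.
Qed.

Lemma all_gap_drop N P1 p P2 G : 0 < N ->
  all (gap_ok N.+1 (P1 ++ p :: P2)) G ->
  all (gap_ok N (P1 ++ P2)) [seq gap_drop p g | g <- G].
Proof.
by move=> N0; rewrite all_map; apply: sub_all => g; apply: gap_drop_ok.
Qed.

Lemma mem_pair_split p P :
  p \in P -> exists P1 P2 : seq (T * T), P = P1 ++ p :: P2.
Proof. by case/splitPr=> P1 P2; exists P1, P2. Qed.

Lemma mem_pair_verts x P : x \in pair_verts P ->
  exists P1 p P2, P = P1 ++ p :: P2 /\ x \in [:: p.1; p.2].
Proof.
case/flatten_mapP=> p /mem_pair_split[P1 [P2 ->]] xp.
by exists P1, p, P2.
Qed.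

Lemma mem_gap_verts x G : x \in gap_verts G ->
  exists (G1 : seq gap) (lo : option (T * T)) s (hi : option (T * T)) G2,
    G = G1 ++ (lo, s, hi) :: G2 /\ x \in s.
Proof.
elim: G => [|[[lo s] hi] G IHG] //; rewrite /gap_verts /= mem_cat.
case/orP=> [xs|/IHG[G1 [lo' [s' [hi' [G2 [-> xs']]]]]]].
  by exists [::], lo, s, hi, G.
by exists ((lo, s, hi) :: G1), lo', s', hi', G2.
Qed.

(* Dominator's answer [y] to a move [x] of Staller keeps the remaining
   vertices in pairs and gaps, and wastes at most half of each gap. *)
Lemma pairing_step N P G x : 0 < N ->
  all (gap_ok N.+1 P) G -> x \in verts P G ->
  exists y P' G',
    [/\ forall z, count_mem z (verts P' G') + (x == z) + (y == z)
                  <= count_mem z (verts P G),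
        all (gap_ok N P') G'
      & forall A, cov P G A -> A y || cov P' G' A].
Proof.
move=> N0 okG; rewrite mem_cat => /orP[].
  (* Staller played in a pair: Dominator takes the partner, and gaps bounded by this pair lose that
     end. *)
  case/mem_pair_verts=> P1 [p [P2 [defP xp]]]; rewrite {P}defP in okG *.
  exists (if x == p.1 then p.2 else p.1), (P1 ++ P2), [seq gap_drop p g | g <- G].
  split=> [z||A].
  - rewrite !count_verts gap_verts_drop !count_pair_verts_cat.
    rewrite count_pair_verts_cons.
    move: xp; rewrite !inE; case: eqVneq => [->|_ /= /eqP->]; lia.
  - exact: all_gap_drop okG.
  - rewrite /cov => /orP[/pair_cov_rem|/has_gap_drop->]; last by rewrite !orbT.
    by case/orP=> [/andP[hx hy]|->]; [case: ifP; rewrite ?hx ?hy | rewrite orbT].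
case/mem_gap_verts=> G1 [lo [s [hi [G2 [defG xs]]]]]; rewrite {G}defG in okG *.
move: okG; rewrite all_cat /= => /and3P[okG1 okg okG2].
have sub PP g' : gap_ok N.+1 P g' -> gap_ok N (P ++ PP) g'.
  by apply: gap_ok_mono => // r rP; rewrite mem_cat rP.
have okG' PP : all (gap_ok N (P ++ PP)) (G1 ++ G2).
  by rewrite all_cat !(sub_all (sub PP)).
(* Only the gap containing [x] changes; [covG] and [countG] reduce both obligations to that gap. *)
have covG A (B : bool) PP GG :
    (gap_cov (lo, s, hi) A -> B || pair_cov PP A || has (gap_cov^~ A) GG) ->
    cov P (G1 ++ (lo, s, hi) :: G2) A -> B || cov (P ++ PP) (GG ++ G1 ++ G2) A.
  rewrite /cov pair_cov_cat !has_cat /= => h.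
  by case/or4P=> [->|->|/h/orP[/orP[]|]->|->]; rewrite ?orbT.
have countG z PP GG m :
    count_mem z (pair_verts PP) + count_mem z (gap_verts GG) + m
      <= count_mem z s ->
    count_mem z (verts (P ++ PP) (GG ++ G1 ++ G2)) + m
      <= count_mem z (verts P (G1 ++ (lo, s, hi) :: G2)).
  rewrite !count_verts !count_pair_verts_cat !count_gap_verts_cat.
  rewrite count_gap_verts_cons /=; lia.
case/splitPr: xs okg covG countG => s1 s2 okg covG countG.
move: (okg) => /and5P[/= + hw hlo hhi ne].
rewrite /weight /= in hw; rewrite size_cat /= addnS /= oddD negb_add => ods.
(* If both sides of [x] are odd, Dominator takes the neighbor of [x] on the side of smaller weight
   and pairs the rest of that side; the other side stays a gap with [x] as its claimed end. *)
have [od1|ev1] := boolP (odd (size s1)).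
  have od2 : odd (size s2) by rewrite -(eqP ods).
  pose wl := size s1 + (isSome lo).*2; pose wr := size s2 + (isSome hi).*2.
  have sw : 2 ^ N.+1 <= wl + wr.
    by move: hw; rewrite size_cat /= /wl /wr; clear; lia.
  (* The larger weight is at least [2 ^ N]; equality is excluded because the weight is odd and
     [2 ^ N] is even. *)
  have big w : odd w -> 2 ^ N.+1 <= w.*2 -> 2 ^ N < w.
    rewrite expnS mul2n leq_double leq_eqVlt => odw /orP[/eqP E|//].
    by move: odw; rewrite -E oddX /=; case: (N) N0.
  case: (leqP wr wl) => [le|/ltnW le].
    case: s2 od2 @wr le sw {ods hw ne hlo hhi} okg covG countG
      => // y s3 ev3 wr le sw okg covG countG; rewrite /= in ev3.
    exists y, (P ++ pairs s3), ([:: (lo, s1, None)] ++ G1 ++ G2); split=> [z||A].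
    - rewrite -addnA; apply: countG; rewrite count_gap_verts1 count_cat /=.
      have := count_pairs z s3; clear; lia.
    - rewrite /= okG' andbT; move: (sub (pairs s3) _ okg) => /and5P[_ _ h3 h4 h5].
      apply/and5P; split=> //=; last by rewrite implybT.
      rewrite /weight /= addn0; apply: big; last by clear -le sw; lia.
      by rewrite oddD odd_double addbF.
    - apply: covG => //; rewrite /gap_cov /= triple_cat /= orbF.
      case/or4P.
      + by move=> h; rewrite (triple_ends _ _ h) // !orbT.
      + by case/and3P=> _ _ ->.
      + by case/and3P=> _ ->.
      + by move/(triple_pairs ev3) => ->; rewrite orbT.
  case/lastP: s1 od1 @wl le sw {ods hw ne hlo hhi} okg covG countG
    => // s3 y ev3 wl le sw okg covG countG; rewrite size_rcons /= in ev3.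
  exists y, (P ++ pairs s3), ([:: (None, s2, hi)] ++ G1 ++ G2); split=> [z||A].
  - rewrite -addnA; apply: countG; rewrite count_gap_verts1 count_cat.
    rewrite -cats1 count_cat /=.
    have := count_pairs z s3; clear; lia.
  - rewrite /= okG' andbT; move: (sub (pairs s3) _ okg) => /and5P[_ _ h3 h4 h5].
    apply/and5P; split=> //=; last by rewrite eq_sym; apply/implyP.
    rewrite /weight /= addn0; apply: big; last by clear -le sw; lia.
    by rewrite oddD odd_double addbF.
  - apply: covG => //; rewrite /gap_cov /= cat_rcons triple_cat /= orbF.
    case/or4P.
    + by move/(triple_pairs ev3) => ->; rewrite orbT.
    + by case/and3P=> _ ->.
    + by case/and3P=> ->.
    + by move=> h; rewrite (triple_ends _ _ h) // !orbT.
(* With both sides even, a neighbor [y] of [x] lies in the triples centered at [x], at [y] and at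
   the vertex beyond [y], which may stay unmatched. The other vertices on each side are even in
   number and get paired. *)
have ev2 : ~~ odd (size s2) by rewrite -(eqP ods).
case: s2 ev2 ods hw okg covG countG => [|y [|z' s4]] //=.
  move=> _ _ hw okg covG countG.
  case/lastP: s1 ev1 hw okg covG countG => [|s1 y] ev1 hw okg covG countG.
    case: lo hlo ne okg covG countG hw => [p|] /=; last first.
      rewrite expnS; move: (N) N0 => [//|M] _; case: hi {hhi} => [?|] ? ? ? ? /=;
      rewrite expnS; have := expn_gt0 2 M; lia.
    move=> pP ne okg covG countG hw.
    (* Here the gap is the single vertex [x]. Its weight forces a pair at the left end, and the
       support vertex [p.1] lies in the only triple of the gap. *)
    have [P1 [P2 defP]] := mem_pair_split pP.
    rewrite {P pP hhi sub okG' okg covG countG}defP in okG1 okG2 *.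
    exists p.1, (P1 ++ P2), [seq gap_drop p g | g <- G1 ++ G2]; split=> [z||A].
    - rewrite !count_verts gap_verts_drop !count_pair_verts_cat.
      rewrite !count_gap_verts_cat count_gap_verts_cons count_pair_verts_cons /=.
      clear; lia.
    - by apply: all_gap_drop => //; rewrite all_cat okG1.
    - rewrite /cov has_cat /= {2}/gap_cov /= orbF.
      have hG : has (gap_cov^~ A) G1 || has (gap_cov^~ A) G2 ->
          has (gap_cov^~ A) [seq gap_drop p g | g <- G1 ++ G2].
        by rewrite -has_cat; apply: has_gap_drop.
      case/or4P=> [/pair_cov_rem/orP[/andP[->]//|->]|h|/and3P[-> //]|h];
        rewrite ?orbT //; by rewrite hG ?h ?orbT.
  case/lastP: s1 ev1 hw okg covG countG => [|s1 z'] //.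
  rewrite !size_rcons /= negbK => ev1 hw okg covG countG.
  exists y, (P ++ pairs s1), ([::] ++ G1 ++ G2); split=> [z||A].
  - rewrite -addnA; apply: countG; rewrite count_cat -!cats1 !count_cat /=.
    have := count_pairs z s1; clear; lia.
  - exact: okG'.
  - apply: covG => //; rewrite /gap_cov /= !cat_rcons triple_cat /= !orbF.
    case/or4P.
    + by move/(triple_pairs ev1) => ->; rewrite orbT.
    + by case/and3P=> _ _ ->.
    + by case/and3P=> _ ->.
    + by case/and3P=> ->.
rewrite negbK => ev4 ods hw okg covG countG.
exists y, (P ++ (pairs s1 ++ pairs s4)), ([::] ++ G1 ++ G2); split=> [z||A].
- rewrite -addnA; apply: countG; rewrite count_pair_verts_cat count_cat /=.
  have := count_pairs z s1; have := count_pairs z s4; clear; lia.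
- exact: okG'.
- apply: covG => //; rewrite /gap_cov /= triple_cat /= pair_cov_cat orbF.
  case/orP; first by move/(triple_pairs ev1) => ->; rewrite orbT.
  case/or4P.
  + by case/and3P=> _ _ ->.
  + by case/and3P=> _ ->.
  + by case/and3P=> ->.
  + by move/(triple_pairs ev4) => ->; rewrite !orbT.
Qed.

Lemma count_le1_uniq (s : seq T) : (forall z, count_mem z s <= 1) -> uniq s.
Proof.
move=> h; apply: count_mem_uniq => z; rewrite -has_pred1 has_count.
by case: (count_mem z s) (h z) => [|[]].
Qed.

(** One inequality between multiplicities records that [y] is available and that the new pairs and
    gaps are repetition-free and avoid [x] and [y]. *)
Lemma uniq_count_removal (x y : T) s s' :
  (forall z, count_mem z s' + (x == z) + (y == z) <= count_mem z s) ->
  uniq s ->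
  [/\ uniq s', x != y, y \in s
    & forall z, z \in s' -> [/\ z \in s, z != x & z != y]].
Proof.
move=> hcnt us.
have c1 z : count_mem z s <= 1 by rewrite count_uniq_mem // leq_b1.
split.
- by apply: count_le1_uniq => z; have := hcnt z; have := c1 z; lia.
- by apply/eqP=> E; have := hcnt y; have := c1 y; rewrite E eqxx; lia.
- by rewrite -has_pred1 has_count; have := hcnt y; rewrite eqxx; lia.
move=> z; rewrite -!has_pred1 !has_count => h'.
have := hcnt z; have := c1 z; rewrite [z == x]eq_sym [z == y]eq_sym.
by case: (x == z); case: (y == z) => /=; split=> //; lia.
Qed.

Lemma triple_inner2 (l r : option T) s A :
  uniq s -> 1 < size s -> triple predT l s r A ->
  exists a b, [/\ a != b, a \in s, b \in s, A a & A b].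
Proof.
case: s => [|c [|d s]] //= => /andP[+ us] _.
rewrite inE negb_or => /andP[cd cs].
case/orP=> [/and3P[_ ca da]|].
  by exists c, d; rewrite !inE !eqxx orbT.
elim: s c d cd cs us => [|f s IHs] c d cd cs us.
  by rewrite /= orbF => /and3P[ca da _]; exists c, d; rewrite !inE !eqxx orbT.
case/orP=> [/and3P[ca da _]|h]; first by exists c, d; rewrite !inE !eqxx orbT.
move: us => /= /andP[]; rewrite inE negb_or => /andP[df ds] /[dup] us /andP[fs _].
have [a [b [ab ain bin aA bA]]] := IHs d f df ds us h.
by exists a, b; split=> //; rewrite inE ?ain ?bin orbT.
Qed.

(** This keeps Staller from completing a covered neighborhood with one move. The bound [2 < weight]
    matters for a gap with a single vertex, which must then have a pair at one of its ends. *)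
Lemma cov_two P (G : seq (option (T * T) * seq T * option (T * T))) A :
  uniq (verts P G) -> all (gap_ok 1 P) G -> cov P G A ->
  exists a b, [/\ a != b, a \in verts P G, b \in verts P G, A a & A b].
Proof.
move=> uV okG.
have inP z : z \in pair_verts P -> z \in verts P G.
  by rewrite /verts mem_cat => ->.
have in1 (p : T * T) : p \in P -> p.1 \in pair_verts P /\ p.2 \in pair_verts P.
  by move=> pP; split; apply/flatten_mapP; exists p; rewrite // !inE eqxx ?orbT.
case/orP=> [/hasP[p pP /andP[A1 A2]]|/hasP[g gG]].
  exists p.1, p.2; have [h1 h2] := in1 p pP; split=> //; try exact: inP.
  have [P1 [P2 defP]] := mem_pair_split pP; move: uV.
  rewrite defP /verts /pair_verts map_cat flatten_cat /= -catA cat_uniq.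
  by case/and3P=> _ _ /= /andP[]; rewrite inE negb_or => /andP[].
have sub s : g.1.2 = s -> {subset s <= gap_verts G}.
  by move=> <- z zs; apply/flatten_mapP; exists g.
have inG z : z \in gap_verts G -> z \in verts P G.
  by rewrite /verts mem_cat => ->; rewrite orbT.
have ug : uniq g.1.2.
  move: uV; rewrite cat_uniq => /and3P[_ _];
  elim: G gG {okG sub inP inG} => // g' G IHG.
  rewrite inE cat_uniq => /orP[/eqP<-|/IHG h] /and3P[h1 _ h2] //; exact: h.
have dis z z' : z \in pair_verts P -> z' \in gap_verts G -> z != z'.
  move=> zP z'G; apply: contraTneq uV => E; rewrite cat_uniq.
  by apply/nandP; right; rewrite negb_and negbK; apply/orP; left;
     apply/hasP; exists z' => //; rewrite -E.
move/(allP okG): gG => /and5P[od w hlo hhi _].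
case: (ltnP 1 (size g.1.2)) => [sz /(triple_inner2 ug sz)|].
  by case=> a [b [ab /sub aG /sub bG aA bA]]; exists a, b; split=> //; apply/inG;
    [apply: aG|apply: bG].
move: od w hlo hhi sub; rewrite /gap_cov /weight {ug}.
case: g => [[lo [|c [|d s]]] hi] //= _ w hlo hhi sub _ /orP[/and3P[Al Ac Ar]|//].
have cG : c \in gap_verts G by apply: (sub _ erefl); rewrite inE.
case: lo Al w hlo => [p|] /=.
  move=> Ap _ /in1[pP _]; exists p.1, c.
  by split=> //; [exact: dis|exact: inP|exact: inG].
case: hi hhi Ar => [p|] //= /in1[pP _] Ap _ _ _.
by exists p.1, c; split=> //; [exact: dis|exact: inP|exact: inG].
Qed.

Lemma triple_subpred q q' (l r : option T) s A :
  subpred q q' -> triple q l s r A -> triple q' l s r A.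
Proof.
move=> sq; elim: s l => [|c s IHs] l //= /orP[/andP[/sq-> ->] //|/IHs->].
exact: orbT.
Qed.

Lemma cov_catl (P1 P2 : seq (T * T)) G1 G2 A :
  cov P1 G1 A -> cov (P1 ++ P2) (G1 ++ G2) A.
Proof. by rewrite /cov pair_cov_cat has_cat => /orP[]->; rewrite ?orbT. Qed.

Lemma cov_catr (P1 P2 : seq (T * T)) G1 G2 A :
  cov P2 G2 A -> cov (P1 ++ P2) (G1 ++ G2) A.
Proof. by rewrite /cov pair_cov_cat has_cat => /orP[]->; rewrite ?orbT. Qed.

Lemma count_verts_cat z (P1 P2 : seq (T * T)) G1 G2 :
  count_mem z (verts (P1 ++ P2) (G1 ++ G2)) =
  count_mem z (verts P1 G1) + count_mem z (verts P2 G2).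
Proof.
by rewrite !count_verts count_pair_verts_cat count_gap_verts_cat addnACA.
Qed.

End Pairing.

(** * Monotonicity of the game and Dominator's invariant *)

Section GameFacts.

Variables (T : finType) (e : rel T).
Implicit Types (D S : {set T}).

Local Notation N := (closed_nbh e).
Local Notation forces := (staller_forces e).

Lemma forces_subD n D D' S : D \subset D' -> forces n D' S -> forces n D S.
Proof.
elim: n D D' S => [|n IHn] D D' S sD //= /orP[->//|/existsP[x /andP[xF dt]]].
have sF R : free D' R \subset free D R by rewrite setCS setSU.
apply/orP; right; apply/existsP; exists x; rewrite (subsetP (sF S)) //=.
case/orP: dt => [w|/andP[/set0Pn[z zF] /forall_inP h]].
  by rewrite /dominator_turn w.
apply/orP; right; apply/andP; split.
  by apply/set0Pn; exists z; apply: (subsetP (sF _)).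
apply/forall_inP=> y yF.
(* A move at a vertex that the larger set already contains is replaced by some free vertex [z], so
   that the inclusion persists. *)
have [yD'|yD'] := boolP (y \in D').
  apply: IHn (h z zF); apply/subsetP=> t; rewrite !inE.
  by case/orP=> [/eqP->|/(subsetP sD)->]; rewrite ?yD' orbT.
apply: IHn (h y _); first by rewrite setUS.
by move: yF yD'; rewrite !inE => /norP[_ /norP[/negPf-> /negPf->]] /negPf->.
Qed.

Lemma forces_leq m n D S : m <= n -> forces m D S -> forces n D S.
Proof.
elim: m n D S => [|m IHm] n D S; first by case: n => [|n] _ //=; rewrite orbF => ->.
case: n => // n lemn /= /orP[->//|/existsP[x /andP[xF dt]]].
apply/orP; right; apply/existsP; exists x; rewrite xF /=.
case/orP: dt => [w|/andP[nz /forall_inP h]]; first by rewrite /dominator_turn w.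
apply/orP; right; rewrite nz /=; apply/forall_inP=> y yF.
exact: IHm (h y yF).
Qed.

Lemma not_won D S P G x :
  uniq (verts P G) -> {subset verts P G <= free D S} ->
  all (gap_ok 1 P) G -> x \notin D -> [disjoint D & S] ->
  (forall v, [exists y in D, y \in N v] || cov P G (mem (N v))) ->
  ~~ staller_won e (x |: S).
Proof.
move=> uV sV okG xD dDS hc; apply/existsP=> -[v /subsetP sub].
case/orP: (hc v) => [/exists_inP[y yD /sub]|cv].
  rewrite !inE => /orP[/eqP E|yS]; first by rewrite -E yD in xD.
  by rewrite (disjointFr dDS yD) in yS.
have [a [b [ab aV bV /sub aN /sub bN]]] := cov_two uV okG cv.
move: (sV a aV) (sV b bV) aN bN; rewrite !inE.
case/norP=> _ /negPf-> /norP[_ /negPf->]; rewrite !orbF.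
by move=> /eqP E /eqP F; rewrite E F eqxx in ab.
Qed.

(** The invariant is that each closed neighborhood contains a vertex of Dominator or is covered by
    pairs and gaps. A round keeps it by [pairing_step] and lowers [n] by one; for the last move
    [not_won] applies. *)
Lemma pairing_holds n D S P G : 0 < n ->
  uniq (verts P G) -> {subset verts P G <= free D S} ->
  all (gap_ok n P) G -> [disjoint D & S] ->
  (forall v, [exists y in D, y \in N v] || cov P G (mem (N v))) ->
  ~~ forces n D S.
Proof.
elim: n D S P G => // n IHn D S P G _ uV sV okG dDS hc.
have ok1 : all (gap_ok 1 P) G by apply: sub_all okG => g; apply: gap_ok_mono.
have nw x : x \notin D -> ~~ staller_won e (x |: S).
  by move=> xD; apply: (not_won uV sV ok1).
have nwS : ~~ staller_won e S.
  apply/existsP=> -[v sv].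
  case/orP: (hc v) => [/exists_inP[y yD /(subsetP sv) yS]|cv].
    by rewrite (disjointFr dDS yD) in yS.
  have [a [b [_ /sV aV _ /(subsetP sv) aS _]]] := cov_two uV ok1 cv.
  by move: aV; rewrite !inE aS orbT.
rewrite /= (negPf nwS) /=; apply/exists_inP=> -[x xF].
have [xD xS] : x \notin D /\ x \notin S by move: xF; rewrite !inE => /norP.
have dDx : [disjoint D & x |: S].
  rewrite disjoint_subset; apply/subsetP=> z zD.
  rewrite !inE (disjointFr dDS zD) orbF.
  by apply: contraNneq xD => <-.
rewrite /dominator_turn (negPf (nw x xD)) /= => /andP[/set0Pn[y0 y0F] /forall_inP h].
case: n IHn okG h => [|n] IHn okG h.
  by move: (h y0 y0F); rewrite /= orbF (negPf (nw x xD)).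
(* A move outside the pairs and gaps needs no answer: any reply [y0] will do, and it is then ignored
   by monotonicity. *)
have [xV|xV] := boolP (x \in verts P G); last first.
  have := h y0 y0F; apply/negP.
  apply: contra (@forces_subD _ D _ _ (subsetUr _ _)) _.
  apply: (IHn _ _ P G) => // [z zV|].
    have := sV z zV; rewrite !inE => /norP[/negPf-> /negPf->]; rewrite orbF.
    by apply: contraNneq xV => <-.
  by apply: sub_all okG => g; apply: gap_ok_mono.
have [y [P' [G' [hcnt ok' hcov]]]] := pairing_step (ltn0Sn n) okG xV.
have [uV' xy yV sub] := uniq_count_removal hcnt uV.
have yF : y \in free D (x |: S).
  by have := sV y yV; rewrite !inE [y == x]eq_sym (negPf xy).
have := h y yF; apply/negP; apply: (IHn _ _ P' G') => //.
- move=> z /sub[/sV]; rewrite !inE => /norP[/negPf-> /negPf->].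
  by move=> /negPf-> /negPf->.
- rewrite disjoint_subset; apply/subsetP=> z; rewrite in_setU1.
  case/orP=> [/eqP->|zD]; last by rewrite inE (disjointFr dDx zD).
  by move: yF; rewrite !inE => /norP[_ ->].
- move=> v; case/orP: (hc v) => [/exists_inP[t tD tN]|/hcov/orP[yN|->]].
  + by apply/orP; left; apply/exists_inP; exists t; rewrite // !inE tD orbT.
  + by apply/orP; left; apply/exists_inP; exists y; rewrite // !inE eqxx.
  + by rewrite orbT.
Qed.

End GameFacts.

(** * Staller's halving strategy on a chain *)

Section StallerStrategy.

Variables (T : finType) (e : rel T).
Implicit Types (D S : {set T}) (s : seq T).

Local Notation N := (closed_nbh e).
Local Notation forces := (staller_forces e).

(** Positions count from 0, so the even ones are [u_1], [u_3] and so on; [j] is at most one away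
    from [i]. The default of [nth] is never reached, as [j < size s]. *)
Definition chain S s := forall i, i < size s -> ~~ odd i ->
  exists v, forall z, z \in N v ->
    z \in S \/ exists2 j, [&& j < size s, j <= i.+1 & i <= j.+1] & z = nth z s j.

Lemma chain_take S s m x :
  m < size s -> x = nth x s m -> chain S s -> chain (x |: S) (take m s).
Proof.
move=> lt_m defx ch i; rewrite size_take lt_m => lt_i ev_i.
have [v hv] := ch i (ltn_trans lt_i lt_m) ev_i; exists v => z /hv.
case=> [zS|[j /and3P[j1 j2 j3] defz]]; first by left; rewrite !inE zS orbT.
have [lt_j|le_j] := ltnP j m.
  by right; exists j; [lia | rewrite nth_take].
left; rewrite !inE; apply/orP; left; apply/eqP.
by rewrite defz defx (_ : j = m); [apply: set_nth_default | lia].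
Qed.

(** The shift by [m.+1] preserves parity because [m] is odd, and the only entry cut off from a
    remaining neighborhood is [x], which Staller now owns. *)
Lemma chain_drop S s m x :
  odd m -> m < size s -> x = nth x s m -> chain S s ->
  chain (x |: S) (drop m.+1 s).
Proof.
move=> od_m lt_m defx ch i; rewrite size_drop => lt_i ev_i.
have [||v hv] := ch (m.+1 + i); [lia | by rewrite oddD /= od_m | exists v => z /hv].
case=> [zS|[j /and3P[j1 j2 j3] defz]]; first by left; rewrite !inE zS orbT.
have [lt_j|le_j] := ltnP m j.
  right; exists (j - m.+1); first by lia.
  by rewrite nth_drop subnKC.
left; rewrite !inE; apply/orP; left; apply/eqP.
by rewrite defz defx (_ : j = m); [apply: set_nth_default | lia].
Qed.

(* Claiming a vertex in odd position [m] (counted from 0) leaves two chains,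
   of which Dominator can spoil only one. *)
Lemma chain_forces n D S s :
  odd (size s) -> size s < 2 ^ n -> uniq s -> {subset s <= free D S} ->
  chain S s -> forces n D S.
Proof.
elim: n D S s => [|n IHn] D S s od_s lt_s us sF ch.
  by case: s od_s lt_s {us sF ch}.
rewrite /=; apply/orP; right; apply/existsP.
have [sz1|sz3] := leqP (size s) 1.
  case: s od_s lt_s us sF ch sz1 => [|x [|]] //= _ _ _ sF ch _.
  exists x; rewrite sF ?inE //=; apply/orP; left.
  have [//|//|v hv] := ch 0; apply/existsP; exists v; apply/subsetP=> z /hv.
  case=> [zS|[[|j] // _ ->]]; rewrite !inE ?zS ?orbT ?eqxx //.
have n0 : 0 < n by case: (n) lt_s; rewrite ?expn1; lia.
have ev2 : ~~ odd (2 ^ n) by rewrite oddX; case: (n) n0.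
(* Both terms are odd, as [2 ^ n] is even and [size s] is odd. The first keeps the left part shorter
   than [2 ^ n], the second keeps the right part nonempty. *)
pose m := minn (2 ^ n).-1 (size s).-2.
have [od_m lt_m le1 le2] : [/\ odd m, m < size s, m < 2 ^ n & size s - m.+1 < 2 ^ n].
  by move: lt_s; rewrite expnS /m => lt_s; split; lia.
have [x0 _] : exists x0 : T, true by case: (s) sz3 => // x0; exists x0.
pose x := nth x0 s m.
have defx : x = nth x s m by apply: set_nth_default.
have defs : s = take m s ++ x :: drop m.+1 s.
  by rewrite -drop_nth // cat_take_drop.
have := us; rewrite {1}defs cat_uniq /= negb_or.
case/and3P=> u1 /andP[x1 dis] /andP[x2 u2].
exists x; rewrite sF ?mem_nth //=; apply/orP; right.
have sF' s' y : {subset s' <= s} -> x \notin s' -> y \notin s' ->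
    {subset s' <= free (y |: D) (x |: S)}.
  move=> sub xs' ys' z zs'; have := sF z (sub z zs'); rewrite !inE.
  case/norP=> /negPf-> /negPf->; rewrite !orbF negb_or.
  by rewrite (memPn ys') ?(memPn xs').
have sub1 : {subset take m s <= s} by move=> z /mem_take.
have sub2 : {subset drop m.+1 s <= s} by move=> z /mem_drop.
apply/andP; split.
  apply/set0Pn; case def1: (take m s) => [|a s1].
    by move: (congr1 size def1); rewrite size_take lt_m /=; case: (m) od_m.
  have a1 : a \in take m s by rewrite def1 inE eqxx.
  exists a; have := sF a (sub1 a a1); rewrite !inE => /norP[/negPf-> /negPf->].
  by rewrite (negPf (memPn x1 a a1)).
apply/forall_inP=> y yF.
have [y1|y1] := boolP (y \in take m s).
  apply: (IHn _ _ (drop m.+1 s)) => //.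
  - by rewrite size_drop oddB // od_s /= od_m.
  - by rewrite size_drop.
  - by apply: sF' => //; apply: contra dis => y2; apply/hasP; exists y.
  - exact: chain_drop.
apply: (IHn _ _ (take m s)) => //; rewrite ?size_take ?lt_m //.
- exact: sF'.
- exact: chain_take.
Qed.

End StallerStrategy.

(** * Edges of vertex sequences and maximality of paths *)

Section Trees.

Variables (T : finType) (e : rel T).
Hypothesis esym : symmetric e.
Implicit Types (s : seq T) (P Q : vseq T).

Definition edges s : seq {set T} := [seq [set q.1; q.2] | q <- zip s (behead s)].

Lemma edgesP s (E : {set T}) :
  reflect (exists s1 a b s2, s = s1 ++ a :: b :: s2 /\ E = [set a; b])
          (E \in edges s).
Proof.
apply: (iffP idP) => [|[s1 [a [b [s2 [-> ->]]]]]]; last first.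
  elim: s1 => [|c s1 IHs]; first by rewrite inE eqxx.
  by case: s1 IHs => [|d s1] /= IHs; rewrite inE IHs orbT.
elim: s => [|a [|b s] IHs] //; rewrite inE => /orP[/eqP->|].
  by exists [::], a, b, s.
by case/IHs=> s1 [c [d [s2 [-> ->]]]]; exists (a :: s1), c, d, s2.
Qed.

Lemma mem_edges s E z : E \in edges s -> z \in E -> z \in s.
Proof.
case/edgesP=> s1 [a [b [s2 [-> ->]]]]; rewrite !inE mem_cat !inE.
by case/orP=> ->; rewrite !orbT.
Qed.

Lemma edges_rev s : edges (rev s) =i edges s.
Proof.
have h s' E : E \in edges s' -> E \in edges (rev s').
  case/edgesP=> s1 [a [b [s2 [-> ->]]]]; apply/edgesP.
  exists (rev s2), b, a, (rev s1); split; last exact: setUC.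
  by rewrite rev_cat !rev_cons -!cats1 -!catA.
by move=> E; apply/idP/idP=> [/h|/h]; rewrite ?revK.
Qed.

Lemma sorted_rev s : sorted e s -> sorted e (rev s).
Proof. by rewrite rev_sorted; apply: sub_sorted => x y; rewrite esym. Qed.

Lemma sorted_adjacent s1 a b s2 : sorted e (s1 ++ [:: a, b & s2]) -> e a b.
Proof. by case/cat_sorted2=> _ /= /andP[]. Qed.

Lemma uniq_vseq s : uniq s -> exists P : vseq T, P = s :> seq T.
Proof.
move=> us; have h : size s <= #|T| by rewrite -(card_uniqP us) max_card.
by exists (Bseq h).
Qed.

Lemma in_paths P : (P \in paths e) =
  [&& P != [::] :> seq T, sorted e P & uniq P].
Proof. by rewrite inE. Qed.

Lemma maximal_mem P s : maximal_path e P -> uniq s -> sorted e s ->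
  {subset (P : seq T) <= s} -> {subset edges P <= edges s} ->
  {subset s <= (P : seq T)}.
Proof.
case/andP=> PP /forall_inP maxP us ss sub sube.
have [Q defQ] := uniq_vseq us.
have QP : Q \in paths e.
  rewrite in_paths defQ us ss !andbT; apply: contraTneq PP => E.
  rewrite in_paths; case: (bseqval P) sub => [|a p] // /(_ a).
  by rewrite E in_nil mem_head => /(_ isT).
have := maxP Q QP; have -> : subpath P Q.
  apply/andP; split; apply/allP=> z zP; last first.
    by rewrite /path_edges defQ; apply: sube.
  by have : z \in (Q : seq T) by rewrite defQ; apply: sub.
by case/andP=> /allP + _; rewrite defQ.
Qed.

(** Since [x] occurs only once in [x :: t], it meets only the first edge there. So the second
    vertices agree, and the argument repeats from them. *)
Lemma prefix_edges x s t : uniq (x :: s) -> uniq (x :: t) ->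
  {subset edges (x :: s) <= edges (x :: t)} -> exists t', t = s ++ t'.
Proof.
elim: s x t => [|a s IHs] x t us ut sub; first by exists t.
have /sub/edgesP[s1 [b [c [s2 [defxt E]]]]] : [set x; a] \in edges [:: x, a & s].
  by rewrite inE eqxx.
have [nax xs] : a != x /\ x \notin s.
  by move: us => /= /andP[]; rewrite inE negb_or eq_sym => /andP[].
case: s1 defxt => [|d s1] /= [? deft]; last first.
  case/andP: ut => + _; rewrite deft.
  have : x \in [set b; c] by rewrite -E !inE eqxx.
  by rewrite !inE mem_cat !inE => /orP[]/eqP->; rewrite eqxx ?orbT.
subst b; have {E} Ec : c = a.
  have : a \in [set x; c] by rewrite -E !inE eqxx orbT.
  by rewrite !inE (negPf nax) => /eqP.
subst c; have [t' defs2] : exists t', s2 = s ++ t'.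
  apply: (IHs a); first by case/andP: us.
    by move: ut; rewrite deft => /andP[].
  move=> E Es; have := sub E; rewrite deft !inE Es orbT => /(_ isT).
  case/orP=> // /eqP defE; have : x \in a :: s.
    by apply: (mem_edges Es); rewrite defE !inE eqxx.
  by rewrite inE eq_sym (negPf nax) (negPf xs).
by exists t'; rewrite deft defs2.
Qed.

(* A path both of whose ends are leaves cannot be extended, hence any path
   containing it runs along it from one end to the other. *)
Lemma leaf_ends_maximal P x x' s t y y' :
  P = [:: x, x' & s] :> seq T -> P = rcons (rcons t y') y :> seq T ->
  sorted e P -> uniq P ->
  (forall z, e x z -> z = x') -> (forall z, e y z -> z = y') ->
  maximal_path e P.
Proof.
move=> defx defy sP uP hx hy; rewrite /maximal_path in_paths sP uP defx /=.
apply/forall_inP=> Q; rewrite in_paths => /and3P[_ sQ uQ].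
apply/implyP=> /andP[/allP mPQ /allP ePQ].
suff [m ed] : (P : seq T) =i Q /\ edges P =i edges Q.
  apply/andP; split; apply/allP=> z zQ; first by rewrite /= m.
  by move: zQ; rewrite -/(edges Q) -/(edges P) /= ed.
(* As [x] has a single neighbor, it cannot be an inner vertex of [Q]; reversing [Q] if necessary
   puts it first. *)
suff h q : q =i Q -> edges q =i edges Q -> sorted e q -> uniq q ->
    head x q = x -> (P : seq T) =i Q /\ edges P =i edges Q.
  have xQ : x \in (Q : seq T) by apply: mPQ; rewrite defx inE eqxx.
  have [q1 [q2 defQ]] : exists q1 q2, Q = q1 ++ x :: q2 :> seq T.
    by case/splitPr: xQ => q1 q2; exists q1, q2.
  case/lastP: q1 defQ => [|q1 a] defQ.
    by apply: (h Q) => //; rewrite defQ.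
  case: q2 defQ => [|b q2] defQ.
    apply: (h (rev Q)); rewrite ?rev_uniq ?sorted_rev //.
    - by move=> z; rewrite mem_rev.
    - exact: edges_rev.
    - by rewrite defQ rev_cat.
  move: (sQ) (sQ); rewrite {1}defQ cat_rcons => /sorted_adjacent.
  rewrite esym => /hx Ea.
  rewrite defQ => /sorted_adjacent/hx Eb.
  by move: uQ; rewrite defQ Ea Eb cat_rcons cat_uniq /= !inE eqxx orbT !andbF.
move=> mq eq sq uq hq.
have defq : q = x :: behead q.
  have : x \in q by rewrite mq; apply: mPQ; rewrite defx inE eqxx.
  by case: q hq {mq eq sq uq} => //= a q ->.
have [q' defq'] : exists q', behead q = (x' :: s) ++ q'.
  apply: (@prefix_edges x); rewrite -?defx -?defq //.
  by move=> E EP; rewrite eq; apply: ePQ.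
have qE : q = P ++ q' by rewrite defq defq' defx.
suff q'0 : q' = [::] by rewrite q'0 cats0 in qE; rewrite -qE.
case: q' qE {defq'} => // z q' qE; exfalso.
move: sq uq; rewrite qE defy cat_rcons => /sorted_adjacent/hy->.
by rewrite cat_rcons cat_uniq /= !inE eqxx orbT !andbF.
Qed.

End Trees.

(** * Paths in acyclic graphs; clean odd paths as chains *)

Section Acyclic.

Variables (T : finType) (e : rel T).
Hypotheses (esym : symmetric e) (eirr : irreflexive e).
Hypothesis acyclic : forall c : seq T, ucycle e c -> size c <= 2.
Hypothesis has_nbr : forall x, exists y, e x y.
Implicit Types (s W : seq T) (P : vseq T).

(** The edge between [a] and [b] closes the segment to a cycle, which has more than two vertices
    unless [s2] is empty. *)
Lemma no_chord s1 a s2 b s3 :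
  uniq (s1 ++ a :: s2 ++ b :: s3) -> sorted e (s1 ++ a :: s2 ++ b :: s3) ->
  e a b -> s2 = [::].
Proof.
move=> us /cat_sorted2[_] /=; rewrite cat_path /= => /and3P[p1 p2 _] eab.
have /acyclic : ucycle e (a :: rcons s2 b).
  apply/andP; split; first by rewrite /= !rcons_path p1 p2 last_rcons esym eab.
  move: us; rewrite cat_uniq => /and3P[_ _].
  by rewrite -cat_rcons -cat_cons cat_uniq => /and3P[].
by rewrite /= size_rcons; case: s2 {us p1 p2}.
Qed.

Lemma nbr_in_path s1 c s2 y :
  uniq (s1 ++ c :: s2) -> sorted e (s1 ++ c :: s2) ->
  y \in s1 ++ c :: s2 -> e c y ->
  (exists s1', s1 = rcons s1' y) \/ (exists s2', s2 = y :: s2').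
Proof.
move=> us ss; rewrite mem_cat inE => /or3P[ys|/eqP->|ys] ecy.
- left; case/splitPr: ys us ss => t1 t2; rewrite -catA /= => us ss.
  by exists t1; rewrite (no_chord us ss) ?cats1 // esym.
- by rewrite eirr in ecy.
- right; case/splitPr: ys us ss => t1 t2 us ss.
  by exists t2; rewrite (no_chord us ss).
Qed.

Lemma off_path_no_two_nbrs s1 a s2 b s3 v :
  uniq (s1 ++ a :: s2 ++ b :: s3) -> sorted e (s1 ++ a :: s2 ++ b :: s3) ->
  v \notin s1 ++ a :: s2 ++ b :: s3 -> e v a -> e v b -> False.
Proof.
move=> us /cat_sorted2[_] /=; rewrite cat_path /= => /and3P[p1 p2 _] vs eva evb.
have /acyclic : ucycle e (v :: a :: rcons s2 b).
  apply/andP; split.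
    by rewrite /= !rcons_path p1 p2 last_rcons eva esym evb.
  move: us; rewrite cat_uniq => /and3P[_ _].
  rewrite -cat_rcons -cat_cons cat_uniq cons_uniq => /and3P[-> _ _].
  rewrite andbT; apply: contra vs; rewrite mem_cat -cat_rcons -cat_cons mem_cat.
  by move=> ->; rewrite orbT.
by rewrite /= size_rcons.
Qed.

Lemma off_path_nbr s v a b : uniq s -> sorted e s -> v \notin s ->
  a \in s -> b \in s -> e v a -> e v b -> a = b.
Proof.
move=> us ss vs ain bin eva evb.
case/splitPr: ain us ss vs bin => s1 s2 us ss vs.
rewrite mem_cat inE => /or3P[bs|/eqP-> //|bs]; exfalso.
  case/splitPr: bs us ss vs => t1 t2; rewrite -catA /= => us ss vs.
  exact: (off_path_no_two_nbrs us ss vs).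
case/splitPr: bs us ss vs => t1 t2 us ss vs.
exact: (off_path_no_two_nbrs us ss vs).
Qed.

(** A neighbor of the first vertex off the path would extend it, and one further along would be a
    chord. *)
Lemma maximal_head P x s y :
  maximal_path e P -> P = x :: s :> seq T -> e x y -> exists s', s = y :: s'.
Proof.
move=> maxP defP exy.
have /and3P[_ sP uP] : [&& P != [::] :> seq T, sorted e P & uniq P].
  by case/andP: maxP; rewrite in_paths.
have [yP|yP] := boolP (y \in (P : seq T)).
  rewrite defP in yP uP sP.
  by have [[[]]|] := @nbr_in_path [::] x s y uP sP yP exy.
suff : y \in (P : seq T) by rewrite (negPf yP).
apply: (maximal_mem maxP (s := y :: P)).
- by rewrite /= yP.
- by rewrite defP /= esym exy; move: sP; rewrite defP.
- by move=> z zP; rewrite inE zP orbT.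
- move=> E /edgesP[s1 [a [b [s2 [-> ->]]]]].
  by apply/edgesP; exists (y :: s1), a, b, s2.
- exact: mem_head.
Qed.

Lemma maximal_last P x s y :
  maximal_path e P -> P = rcons s x :> seq T -> e x y ->
  exists s', s = rcons s' y.
Proof.
move=> maxP defP exy.
have /and3P[_ sP uP] : [&& P != [::] :> seq T, sorted e P & uniq P].
  by case/andP: maxP; rewrite in_paths.
have [yP|yP] := boolP (y \in (P : seq T)).
  rewrite defP -cats1 in yP uP sP.
  by have [|[]] := @nbr_in_path s x [::] y uP sP yP exy.
suff : y \in (P : seq T) by rewrite (negPf yP).
apply: (maximal_mem maxP (s := rcons P y)).
- by rewrite rcons_uniq yP.
- rewrite defP -cats1 cat_rcons sorted_cat_cons /= exy !andbT.
  by move: sP; rewrite defP.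
- by move=> z zP; rewrite mem_rcons inE zP orbT.
- move=> E /edgesP[s1 [a [b [s2 [-> ->]]]]].
  by apply/edgesP; exists s1, a, b, (rcons s2 y); rewrite rcons_cat.
- by rewrite mem_rcons mem_head.
Qed.

Lemma deg2_nbr v a b z : deg e v = 2 -> e v a -> e v b -> a != b ->
  e v z -> z = a \/ z = b.
Proof.
move=> dv eva evb ab evz.
have /eqP E : [set a; b] == [set u | e v u].
  rewrite eqEcard cards2 ab -/(deg e v) dv andbT.
  by apply/subsetP=> u; rewrite !inE => /orP[]/eqP->.
have : z \in [set a; b] by rewrite E inE.
by rewrite !inE => /orP[]/eqP; [left|right].
Qed.

(** The ends have no neighbor off the path by maximality, and the other even positions have degree 2
    by cleanness. The vertices [u_2] and [u_{k-1}], whose degree is unrestricted, sit at odd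
    positions. *)
Lemma clean_odd_chain P : P \in clean_odd_maximal_paths e ->
  [/\ uniq P, odd (size P), 2 < size P & chain e set0 P].
Proof.
rewrite !inE => /andP[/andP[maxP odP] /forallP clP].
have /and3P[_ sP uP] : [&& P != [::] :> seq T, sorted e P & uniq P].
  by case/andP: maxP; rewrite in_paths.
have sz : 2 < size P.
  case defP: (bseqval P) odP => [|x [|y []]] // _.
  have [y exy] := has_nbr x; by have [] := maximal_head maxP defP exy.
split=> // i lti evi.
have [x0 _] : exists x0 : T, true by case: (bseqval P) sz => // x; exists x.
exists (nth x0 P i) => z; rewrite inE => /orP[/eqP->|ez].
  by right; exists i; [lia | apply: set_nth_default].
right; have [i0|i_gt0] := posnP i.
  subst i; case defP: (bseqval P) lti ez => [|x s] //= _ exz.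
  have [s' ->] := maximal_head maxP defP exz.
  by exists 1.
have [il|i_lt] := eqVneq i (size P).-1.
  case/lastP defP: (bseqval P) sz lti il ez => [|s x] //.
  rewrite size_rcons /= => sz lti ->; rewrite nth_rcons ltnn eqxx => exz.
  have [s' defs] := maximal_last maxP defP exz.
  exists (size s'); first by rewrite defs !size_rcons; lia.
  by rewrite defs !nth_rcons size_rcons ltnSn ltnn eqxx.
have dg : deg e (nth x0 P i) = 2.
  (* Parity gives this: [i] and [(size P).-1] are both even, and [i] differs from 0 and from
     [(size P).-1]. *)
  have bnd : 3 <= i.+1 <= size P - 2 by lia.
  have := clP (Ordinal lti); rewrite (tnth_nth x0) => /implyP h.
  exact/eqP/(h bnd).
have lt1 : i.+1 < size P by lia.
have e1 : e (nth x0 P i) (nth x0 P i.+1) by move/sortedP: sP; apply.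
have e2 : e (nth x0 P i) (nth x0 P i.-1).
  by rewrite esym; have := sortedP x0 sP i.-1; rewrite prednK //; apply.
have lt2 : i.-1 < size P by lia.
have nei : i.-1 != i.+1 by lia.
have ne : nth x0 P i.-1 != nth x0 P i.+1 by rewrite nth_uniq.
case: (deg2_nbr dg e2 e1 ne ez) => ->.
  by exists i.-1; [lia | apply: set_nth_default].
by exists i.+1; [lia | apply: set_nth_default].
Qed.

End Acyclic.

(** * Trimming the spine so that it ends in support vertices *)

Section Spine.

Variables (T : finType) (e : rel T).
Hypotheses (esym : symmetric e) (eirr : irreflexive e).
Hypothesis acyclic : forall c : seq T, ucycle e c -> size c <= 2.
Hypothesis has_nbr : forall x, exists y, e x y.
Implicit Types (s W : seq T) (P : vseq T).

Definition covers_edges s := forall x y, e x y -> (x \in s) || (y \in s).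

Definition is_support W w := [exists z, (z \notin W) && e w z].

(** A first vertex that is not a support vertex has only the next vertex of the path as neighbor, so
    dropping it keeps every edge covered. *)
Lemma trim_to_support s : s != [::] -> uniq s -> sorted e s -> covers_edges s ->
  exists s1 x p,
    [/\ s = s1 ++ x :: p, covers_edges (x :: p) & is_support (x :: p) x].
Proof.
elim: s => // x p IHp _ us ss cv.
have [sx|nsx] := boolP (is_support (x :: p) x); first by exists [::], x, p.
have inW y : e x y -> y \in x :: p.
  by move=> exy; apply: contraNT nsx => yp; apply/existsP; exists y; rewrite yp.
have inp y : e x y -> y \in p.
  move=> exy; have [[[]//]|[s' ->]] :=
    nbr_in_path esym eirr acyclic (s1 := [::]) us ss (inW y exy) exy.
  exact: mem_head.
have [||||s1 [x' [p' [-> cv' sx']]]] := IHp.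
- by have [y /inp] := has_nbr x; case: (p).
- by case/andP: us.
- exact: path_sorted ss.
- move=> a b eab; have := cv a b eab; rewrite !inE.
  have [Ea|_] := eqVneq a x; first by rewrite Ea in eab; rewrite (inp _ eab) !orbT.
  have [Eb|//] := eqVneq b x.
  by rewrite esym Eb in eab; rewrite (inp _ eab).
by exists (x :: s1), x', p'.
Qed.

Lemma trim_spine s : s != [::] -> uniq s -> sorted e s -> covers_edges s ->
  exists w W, [/\ uniq (w :: W), sorted e (w :: W), covers_edges (w :: W),
    is_support (w :: W) w & is_support (w :: W) (last w W)].
Proof.
move=> s0 us ss cv.
have [s1 [x [p [defs cvx sx]]]] := trim_to_support s0 us ss cv.
have {us} ux : uniq (x :: p) by move: us; rewrite defs cat_uniq => /and3P[].
have {ss} sp : sorted e (x :: p) by move: ss; rewrite defs => /cat_sorted2[].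
have [||||s2 [w [W [defr cvw sw]]]] := trim_to_support (s := rev (x :: p)).
- by rewrite -size_eq0 size_rev.
- by rewrite rev_uniq.
- exact: sorted_rev.
- by move=> a b /cvx; rewrite !mem_rev.
have sub : {subset w :: W <= x :: p}.
  by move=> z zW; rewrite -mem_rev defr mem_cat zW orbT.
exists w, W; split=> //.
- by have := ux; rewrite -rev_uniq defr cat_uniq => /and3P[].
- by have := sorted_rev esym sp; rewrite defr => /cat_sorted2[].
(* The second trimming only shrinks the spine, so the neighbor of [x] off the spine stays off it. *)
have -> : last w W = x.
  by have := congr1 (last x) defr; rewrite rev_cons last_rcons last_cat.
case/existsP: sx => z /andP[zp exz]; apply/existsP; exists z; rewrite exz andbT.
by apply: contra zp => /sub.
Qed.

End Spine.

(** * Leaves off the spine and the clean odd paths they yield *)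

Section SpineFacts.

Variables (T : finType) (e : rel T).
Hypotheses (esym : symmetric e) (eirr : irreflexive e).
Hypothesis acyclic : forall c : seq T, ucycle e c -> size c <= 2.

Variable W : seq T.
Hypotheses (uW : uniq W) (sW : sorted e W) (cvW : covers_edges e W).
Local Notation sup := (is_support e W).
Implicit Types (s : seq T) (P : vseq T).

Lemma off_nbr_mem v w : v \notin W -> e v w -> w \in W.
Proof. by move=> vW evw; have := cvW evw; rewrite (negPf vW). Qed.

Lemma off_nbr_uniq v a b : v \notin W -> e v a -> e v b -> a = b.
Proof.
move=> vW eva evb.
apply: (off_path_nbr esym acyclic uW sW vW) => //; exact: (off_nbr_mem vW).
Qed.

(** All neighbors of [c] lie on the spine, where acyclicity leaves only the two adjacent
    vertices. *)
Lemma deg_nonsupport t1 p c q t2 : W = rcons t1 p ++ c :: q :: t2 ->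
  ~~ sup c -> deg e c = 2.
Proof.
move=> defW nsc.
have pq : p != q.
  move: uW; rewrite defW cat_rcons cat_uniq => /and3P[_ _ /= /andP[]].
  by rewrite !inE !negb_or => /and3P[].
rewrite /deg (_ : [set u | e c u] = [set p; q]) ?cards2 ?pq //.
apply/setP=> u; rewrite !inE; apply/idP/orP=> [ecu|].
  have uin : u \in W.
    by apply: contraNT nsc => uW'; apply/existsP; exists u; rewrite uW'.
  have := uW; have := sW; rewrite defW in uin *; move=> sW' uW'.
  have [[s' /rcons_inj[_ ->]]|[s' [->]]] :=
    nbr_in_path esym eirr acyclic uW' sW' uin ecu; [by left | by right].
have := sW; rewrite defW => sW'.
case=> /eqP->; last exact: sorted_adjacent sW'.
by move: sW'; rewrite cat_rcons esym => /sorted_adjacent.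
Qed.

(** The leaves [a] and [b] make the path maximal. The ends of the segment become [u_2] and
    [u_{k-1}], where cleanness asks nothing. *)
Lemma clean_odd_path s1 l m s2 a b :
  W = s1 ++ (l :: m) ++ s2 -> odd (size (l :: m)) ->
  (forall i, 0 < i < size m -> deg e (nth l (l :: m) i) = 2) ->
  a \notin W -> b \notin W -> a != b -> e l a -> e (last l m) b ->
  exists2 P, P \in clean_odd_maximal_paths e & P = a :: rcons (l :: m) b :> seq T.
Proof.
move=> defW odm dgm aW bW ab ela elb.
have subm : {subset l :: m <= W}.
  by move=> z zm; rewrite defW !mem_cat zm orbT.
have um : uniq (l :: m).
  by move: uW; rewrite defW cat_uniq => /and3P[_ _]; rewrite cat_uniq => /and3P[].
have sm : sorted e (l :: m).
  by move: sW; rewrite defW => /cat_sorted2[_ /cat_sorted2[]].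
have am : a \notin l :: m by apply: contra aW => /subm.
have bm : b \notin l :: m by apply: contra bW => /subm.
have us : uniq (a :: rcons (l :: m) b).
  by rewrite cons_uniq mem_rcons inE negb_or ab am rcons_uniq bm um.
have [P defP] := uniq_vseq us; exists P => //.
have szP : size P = (size m).+3 by rewrite defP /= size_rcons.
rewrite !inE; apply/andP; split; [apply/andP; split|].
- apply: (@leaf_ends_maximal _ _ esym P a l (rcons m b) (a :: belast l m) b
    (last l m)).
  + exact: defP.
  + by rewrite defP [l :: m]lastI.
  + by rewrite defP /= esym ela rcons_path elb andbT.
  + by rewrite defP.
  + by move=> z eaz; apply: (off_nbr_uniq aW) => //; rewrite esym.
  + by move=> z ebz; apply: (off_nbr_uniq bW) => //; rewrite esym.
- by rewrite szP /= negbK; rewrite /= in odm.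
- apply/forallP=> j; rewrite (tnth_nth l).
  case: (nat_of_ord j) => [|i] //; apply/implyP=> bnd; apply/eqP.
  rewrite szP in bnd; rewrite [in_tuple P : seq T]/= defP.
  change (deg e (nth l (rcons (l :: m) b) i) = 2); rewrite nth_rcons.
  by rewrite (_ : i < size (l :: m)); [apply: dgm | rewrite /=]; clear -bnd; lia.
Qed.

(** A support vertex can be paired with one leaf only; a second leaf produces this shortest clean
    odd path. *)
Lemma clean_odd_star w a b : w \in W -> a \notin W -> b \notin W -> a != b ->
  e w a -> e w b ->
  exists2 P, P \in clean_odd_maximal_paths e & P = [:: a; w; b] :> seq T.
Proof.
move=> wW aW bW ab ewa ewb.
have [s1 [s2 defW]] : exists s1 s2, W = s1 ++ w :: s2.
  by case/splitPr: wW => s1 s2; exists s1, s2.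
by apply: (@clean_odd_path s1 w [::] s2) => //= -[].
Qed.

Lemma clean_odd_gap s1 l acc v s2 a b :
  W = s1 ++ l :: acc ++ v :: s2 -> odd (size acc) -> all (predC sup) acc ->
  a \notin W -> b \notin W -> e l a -> e v b ->
  exists2 P, P \in clean_odd_maximal_paths e
    & P = a :: l :: acc ++ [:: v; b] :> seq T.
Proof.
move=> defW oda nsa aW bW ela evb.
have [||||||P CP defP] := @clean_odd_path s1 l (rcons acc v) s2 a b _ _ _ aW bW.
- by rewrite defW /= cat_rcons.
- by rewrite /= size_rcons /= oda.
- case=> [|i] //=; rewrite size_rcons ltnS => lti.
  rewrite nth_rcons lti.
  have cin : nth l acc i \in acc by rewrite mem_nth.
  have nsc := allP nsa _ cin.
  move: (nth l acc i) cin nsc => c cin nsc.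
  case/splitPr: cin defW {nsa lti oda} => a1 a2 defW.
  case: a2 defW => [|q a2] defW.
    apply: (@deg_nonsupport (s1 ++ belast l a1) (last l a1) _ v s2) => //.
    by rewrite rcons_cat -lastI defW -!catA /=.
  apply: (@deg_nonsupport (s1 ++ belast l a1) (last l a1) _ q (a2 ++ v :: s2)) => //.
  by rewrite rcons_cat -lastI defW -!catA.
- apply/eqP=> E; move: uW; rewrite defW cat_uniq => /and3P[_ _ /= /andP[]].
  rewrite mem_cat inE; have -> : l = v; last by rewrite eqxx orbT.
  by apply: (off_nbr_uniq aW); rewrite esym // E.
- exact: ela.
- by rewrite last_rcons.
by exists P; rewrite // defP /= -!cats1 -catA.
Qed.

Definition leaf_of w := odflt w [pick z | (z \notin W) && e w z].

Lemma leaf_ofP w : sup w -> leaf_of w \notin W /\ e w (leaf_of w).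
Proof.
rewrite /leaf_of => /existsP[z hz]; case: pickP => [y /andP[]//|/(_ z)].
by rewrite hz.
Qed.

End SpineFacts.

(** * Cutting the spine into pairs and gaps *)

Section DominatorStrategy.

Variables (T : finType) (sup : pred T) (leaf : T -> T) (D0 : {set T}).
Implicit Types (s acc R : seq T).

Definition leaf_pair w := if w \in D0 then [::] else [:: (w, leaf w)].

Lemma count_leaf_pair z w :
  count_mem z (verts (leaf_pair w) [::]) =
  if w \in D0 then 0 else (w == z) + (leaf w == z).
Proof. by rewrite /leaf_pair; case: ifP => //= _; rewrite addn0. Qed.

Definition hit (A : pred T) := [exists y in D0, A y].

(** An even segment is paired completely. In an odd one a vertex next to an end owned by Dominator
    may stay unmatched, because the triple centered there contains that end. Without such an end the
    segment becomes a gap. *)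
Lemma segment_pairing n l acc v : l != v ->
  (odd (size acc) -> l \notin D0 -> v \notin D0 -> 2 ^ n < size acc + 4) ->
  exists P G,
    [/\ forall z, count_mem z (verts P G) <= count_mem z acc,
        all (gap_ok n (leaf_pair l ++ leaf_pair v)) G
      & forall A, triple (predC sup) (Some l) acc (Some v) A ->
          hit A || cov P G A].
Proof.
move=> lv long.
have hitI w (A : pred T) : w \in D0 -> A w -> hit A.
  by move=> wD Aw; apply/existsP; exists w; rewrite wD.
have noG s z : count_mem z (verts (pairs s) [::]) <= count_mem z s.
  by rewrite count_verts addn0 count_pairs.
have [od|ev] := boolP (odd (size acc)); last first.
  exists (pairs acc), [::]; split=> // A /(triple_pairs ev) h.
  by rewrite /cov h orbT.
have [lD|lD] := boolP (l \in D0).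
  case: acc od {long} => // y acc /= ev.
  exists (pairs acc), [::]; split=> // [z|A].
    by apply: leq_trans (noG acc z) _; apply: leq_addl.
  case/orP=> [/and3P[_ Al _]|/(triple_pairs ev) h]; first by rewrite (hitI l).
  by rewrite /cov h orbT.
have [vD|vD] := boolP (v \in D0).
  case/lastP: acc od {long} => // acc y; rewrite size_rcons /= => ev.
  exists (pairs acc), [::]; split=> // [z|A].
    by apply: leq_trans (noG acc z) _; rewrite -cats1 count_cat leq_addr.
  rewrite -cats1 triple_cat /= orbF.
  case/orP=> [/(triple_pairs ev) h|/and4P[_ _ _ Av]]; last by rewrite (hitI v).
  by rewrite /cov h orbT.
exists [::], [:: (Some (l, leaf l), acc, Some (v, leaf v))]; split=> [z||A tr].
- by rewrite count_verts count_gap_verts1.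
- rewrite /= andbT; apply/and5P; split=> //=.
  + by rewrite /weight /=; have := long od lD vD; lia.
  + by rewrite /leaf_pair (negPf lD) inE eqxx.
  + by rewrite /leaf_pair (negPf vD) mem_cat !inE eqxx orbT.
  + by apply/implyP=> /eqP[E]; rewrite E eqxx in lv.
- apply/orP; right; rewrite /cov /= orbF.
  by apply: triple_subpred tr.
Qed.

Variable W : seq T.
Hypothesis uW : uniq W.
Hypothesis supD : forall u, u \in D0 -> sup u.

(** The spine is scanned from left to right: [l] is the last support vertex met, [acc] what followed
    it, and [R] lies ahead. The pair of [l] is supplied from outside, so that consecutive segments
    share it. *)
Lemma spine_pairing n s1 l acc R :
  (forall s1 l acc v s2, W = s1 ++ l :: acc ++ v :: s2 -> sup l -> sup v ->
     all (predC sup) acc -> odd (size acc) -> l \notin D0 -> v \notin D0 ->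
     2 ^ n < size acc + 4) ->
  W = s1 ++ l :: acc ++ R -> all (predC sup) acc -> sup l ->
  sup (last l (acc ++ R)) ->
  exists P G,
    [/\ forall z, count_mem z (verts P G) <=
          count_mem z acc + count_mem z [seq w <- R | w \notin D0]
          + count_mem z [seq leaf w | w <- R & sup w],
        all (gap_ok n (leaf_pair l ++ P)) G,
        forall v, v \in R -> sup v -> v \notin D0 -> (v, leaf v) \in P
      & forall A, triple (predC sup) (Some l) (acc ++ R) None A ->
          hit A || cov P G A].
Proof.
move=> long; elim: R s1 l acc => [|v R IHR] s1 l acc defW nsa sl slast.
  exists [::], [::]; split=> // A; rewrite cats0.
  (* The spine ends in a support vertex, so nothing is left in [acc]. *)
  case/lastP: acc nsa slast {defW} => [|acc y] //.
  by rewrite cats0 last_rcons all_rcons /= => /andP[/negPf->].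
have [sv|nsv] := boolP (sup v); last first.
  have vD : v \notin D0 by apply: contra nsv; apply: supD.
  have [||||P [G [h1 h2 h3 h4]]] := IHR s1 l (rcons acc v).
  - by rewrite cat_rcons.
  - by rewrite all_rcons /= nsv.
  - exact: sl.
  - by rewrite cat_rcons.
  exists P, G; split=> // [z|w|A].
  - have := h1 z; rewrite /= vD (negPf nsv) -cats1 count_cat /=; lia.
  - by rewrite inE => /orP[/eqP->|/h3//]; rewrite (negPf nsv).
  - by have := h4 A; rewrite cat_rcons.
have [||||P [G [h1 h2 h3 h4]]] := IHR (s1 ++ l :: acc) v [::] => //.
- by rewrite defW -catA.
- by move: slast; rewrite last_cat.
have lv : l != v.
  apply: contraTneq uW => E; rewrite defW cat_uniq E /= mem_cat inE eqxx orbT.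
  by rewrite !andbF.
have [|P0 [G0 [g1 g2 g3]]] := @segment_pairing n l acc v lv.
  by move=> od; apply: long defW sl sv nsa od.
exists (P0 ++ leaf_pair v ++ P), (G0 ++ [::] ++ G); split=> [z||w|A].
- rewrite !count_verts_cat; have := h1 z; have := g1 z.
  by rewrite count_leaf_pair /= sv; case: (v \in D0) => /=; clear; lia.
- rewrite all_cat; apply/andP; split.
    apply: sub_all g2 => g; apply: gap_ok_mono => // p.
    by rewrite !mem_cat => /orP[]->; rewrite ?orbT.
  apply: sub_all h2 => g; apply: gap_ok_mono => // p.
  by rewrite !mem_cat => /orP[]->; rewrite ?orbT.
- rewrite inE => /orP[/eqP-> _ wD|wR sw wD].
    by rewrite /leaf_pair (negPf wD) !mem_cat mem_head orbT.
  by rewrite !mem_cat h3 // !orbT.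
- rewrite triple_cat /= sv /= => /orP[/g3/orP[->//|h]|/h4/orP[->//|h]].
    by rewrite cov_catl ?orbT.
  by apply/orP; right; apply: cov_catr; rewrite -[G]cat0s; apply: cov_catr.
Qed.

End DominatorStrategy.

(** * Dominator's defense from the initial position *)

Section DominatorHolds.

Variables (T : finType) (e : rel T).
Hypothesis esym : symmetric e.
Hypothesis acyclic : forall c : seq T, ucycle e c -> size c <= 2.
Hypothesis has_nbr : forall x, exists y, e x y.

Variables (w0 : T) (W' : seq T).
Local Notation W := (w0 :: W').
Hypotheses (uW : uniq W) (sW : sorted e W) (cvW : covers_edges e W).
Local Notation sup := (is_support e W).
Hypotheses (sup0 : sup w0) (supl : sup (last w0 W')).

Lemma triple_nbhd (q : pred T) l s v : path e l s -> v \in s -> q v ->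
  triple q (Some l) s None (mem (closed_nbh e v)).
Proof.
move=> + + qv; elim: s l => // c s IHs l /= /andP[elc ps].
rewrite inE => /orP[/eqP E|vs]; last by rewrite IHs ?orbT.
subst c; apply/orP; left; rewrite qv /=; apply/and3P; split.
- by rewrite inE esym elc orbT.
- by rewrite inE eqxx.
by case: s ps {IHs} => //= d s /andP[ecd _]; rewrite !inE ecd orbT.
Qed.

(** The neighborhood of a leaf or of a support vertex meets [D0] or contains a pair, and that of any
    other spine vertex contains a triple of the spine. A pair protects one leaf only, hence the
    condition on leaves. *)
Lemma spine_holds n (D0 : {set T}) : 0 < n ->
  (forall u, u \in D0 -> (u \in W) && sup u) ->
  (forall w a b, w \in W -> w \notin D0 -> a \notin W -> b \notin W ->
     e w a -> e w b -> a = b) ->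
  (forall s1 l acc v s2, W = s1 ++ l :: acc ++ v :: s2 -> sup l -> sup v ->
     all (predC sup) acc -> odd (size acc) -> l \notin D0 -> v \notin D0 ->
     2 ^ n < size acc + 4) ->
  ~~ staller_forces e n D0 set0.
Proof.
move=> n0 supD uniq_leaf long.
pose leaf := leaf_of e W.
have leafP w : sup w -> leaf w \notin W /\ e w (leaf w) by apply: leaf_ofP.
have supD' u : u \in D0 -> sup u by case/supD/andP.
have [P [G [h1 h2 h3 h4]]] :=
  @spine_pairing _ sup leaf D0 W uW supD' n [::] w0 [::] W' long erefl isT sup0 supl.
pose P' := leaf_pair leaf D0 w0 ++ P.
(* [L] is repetition-free, and by [cL] this passes to [verts P' G]. *)
pose L := [seq w <- W | w \notin D0] ++ [seq leaf w | w <- W & sup w].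
have cL z : count_mem z (verts P' G) <= count_mem z L.
  rewrite -[G]cat0s count_verts_cat [count_mem z L]count_cat.
  have := h1 z; rewrite count_leaf_pair /= sup0; case: (w0 \in D0) => /=; lia.
have uL : uniq L.
  rewrite cat_uniq filter_uniq // andTb; apply/andP; split.
    apply/hasPn=> z /mapP[w]; rewrite mem_filter => /andP[/leafP[lW _] _ ->].
    by rewrite mem_filter negb_and lW orbT.
  rewrite map_inj_in_uniq ?filter_uniq // => w w'.
  rewrite !mem_filter => /andP[/leafP[lw ew] _] /andP[/leafP[_ ew'] _] E.
  by apply: (off_nbr_uniq esym acyclic uW sW cvW lw); rewrite esym // E.
have inL z : z \in verts P' G -> z \in L.
  by rewrite -!has_pred1 !has_count => h; apply: leq_trans (cL z).
have LD z : z \in L -> z \notin D0.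
  rewrite mem_cat => /orP[|/mapP[w]]; rewrite mem_filter => /andP[] //.
  by move=> /leafP[lW _] _ ->; apply: contra lW => /supD/andP[].
have inP' w : w \in W -> sup w -> w \notin D0 -> (w, leaf w) \in P'.
  rewrite inE mem_cat => /orP[/eqP->|wW] sw wD; last by rewrite h3 ?orbT.
  by rewrite /leaf_pair (negPf wD) mem_head.
have covP v w : w \in W -> sup w -> w \in closed_nbh e v ->
    leaf w \in closed_nbh e v ->
    [exists y in D0, y \in closed_nbh e v] || cov P' G (mem (closed_nbh e v)).
  move=> wW sw wN lN; have [wD|wD] := boolP (w \in D0).
    by apply/orP; left; apply/existsP; exists w; rewrite wD.
  apply/orP; right; apply/orP; left; apply/hasP; exists (w, leaf w).
    exact: inP'.
  exact/andP.
apply: (@pairing_holds _ _ _ _ _ P' G n0) => //.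
- by apply: count_le1_uniq => z; apply: leq_trans (cL z) _;
    rewrite count_uniq_mem // leq_b1.
- by move=> z /inL/LD zD; rewrite !inE negb_or zD.
- by rewrite disjoint_sym disjoints_subset sub0set.
move=> v; have [vW|vW] := boolP (v \in W); last first.
  have [w evw] := has_nbr v; have wW := off_nbr_mem cvW vW evw.
  have sw : sup w by apply/existsP; exists v; rewrite vW esym.
  have [wD|wD] := boolP (w \in D0).
    by apply/orP; left; apply/existsP; exists w; rewrite wD !inE evw orbT.
  apply: (covP v w) => //; first by rewrite !inE evw orbT.
  have [lW ewl] := leafP w sw.
  (* The leaf chosen for [w] is [v] itself. *)
  by rewrite (uniq_leaf w (leaf w) v) // ?inE ?eqxx // esym.
have [sv|nsv] := boolP (sup v).
  by apply: (covP v v) => //; rewrite !inE ?eqxx //;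
    have [_ ->] := leafP v sv; rewrite orbT.
have vW' : v \in W'.
  by move: vW; rewrite inE => /orP[/eqP E|//]; rewrite E sup0 in nsv.
have /h4 := @triple_nbhd (predC sup) w0 W' v sW vW' nsv.
case/orP=> h; apply/orP; [by left | right].
by rewrite /P' -[G]cat0s; apply: cov_catr.
Qed.

End DominatorHolds.

(** * Minima over finite families *)

Section BigMin.

Variables (I : finType) (Q : pred I) (F : I -> nat) (d : nat).

Lemma bigminn_leq i : Q i -> \big[minn/d]_(j | Q j) F j <= F i.
Proof.
move=> Qi; have : i \in index_enum I by rewrite mem_index_enum.
elim: (index_enum I) => // j r IHr; rewrite inE big_cons.
case/orP=> [/eqP<-|/IHr]; first by rewrite Qi geq_minl.
by case: ifP => // _ h; apply: leq_trans (geq_minr _ _) h.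
Qed.

Lemma bigminn_leq_default : \big[minn/d]_(j | Q j) F j <= d.
Proof. by elim/big_rec: _ => // i x _ h; apply: leq_trans (geq_minr _ _) h. Qed.

Lemma bigminn_attained :
  \big[minn/d]_(j | Q j) F j = d \/
  exists2 i, Q i & \big[minn/d]_(j | Q j) F j = F i.
Proof.
elim/big_ind: _ => [|x y hx hy|i Qi]; [by left | | by right; exists i].
by rewrite /minn; case: ifP.
Qed.

End BigMin.

(** * Determining the least number of moves *)

Section MinMoves.

Variables (T : finType) (win : pred nat).

Lemma min_moves_Some v : v <= #|T| -> win v -> (forall n, n < v -> ~~ win n) ->
  min_moves T win = Some v.
Proof.
move=> lev wv minv; have ltv : v < #|T|.+1 by [].
have ex : [exists n : 'I_#|T|.+1, win n] by apply/existsP; exists (Ordinal ltv).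
rewrite /min_moves ex; congr Some; apply/eqP; rewrite eqn_leq.
rewrite (@bigminn_leq _ _ _ _ (Ordinal ltv)) //=.
have [->//|[i wi ->]] := bigminn_attained
  (fun n : 'I_#|T|.+1 => win n) (fun n => nat_of_ord n) #|T|.
by rewrite leqNgt; apply/negP=> /minv; rewrite wi.
Qed.

Lemma min_moves_None : (forall n, ~~ win n) -> min_moves T win = None.
Proof.
by move=> h; rewrite /min_moves; case: existsP => // -[n]; rewrite (negPf (h n)).
Qed.

End MinMoves.

(** * Bounds for both games on a caterpillar *)

Section Caterpillar.

Variables (T : finType) (e : rel T).
Hypotheses (esym : symmetric e) (eirr : irreflexive e).
Hypothesis acyclic : forall c : seq T, ucycle e c -> size c <= 2.
Hypothesis has_nbr : forall x, exists y, e x y.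

Local Notation C := (clean_odd_maximal_paths e).
Local Notation forces := (staller_forces e).

Lemma clean_odd_forces (P : vseq T) (D : {set T}) : P \in C ->
  (forall z, z \in (P : seq T) -> z \notin D) ->
  forces (up_log 2 (size P)) D set0.
Proof.
move=> PC PD; have [uP odP szP ch] := clean_odd_chain esym eirr acyclic has_nbr PC.
apply: chain_forces ch => // [|z zP]; last by rewrite !inE orbF PD.
(* [chain_forces] needs a strict bound; [size P] is odd and above 2, hence no power of 2. *)
have := up_logP (size P) (isT : 1 < 2); rewrite leq_eqVlt => /orP[/eqP E|//].
move: odP; rewrite {1}E oddX orbF; case: (up_log 2 (size P)) E => // E.
by rewrite E in szP.
Qed.

(** Every vertex has a neighbor, so a closed neighborhood has at least two vertices. *)
Lemma forces_small n (D : {set T}) : n <= 1 -> ~~ forces n D set0.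
Proof.
move=> n1; apply: contra (forces_leq n1) _.
have nw (x : T) (S : {set T}) : S \subset [set x] -> staller_won e S = false.
  move=> sS; apply/existsP=> -[v sv]; have [y evy] := has_nbr v.
  have sub := subsetP (subset_trans sv sS).
  have := sub v; rewrite !inE eqxx => /(_ isT)/eqP Ev.
  have := sub y; rewrite !inE evy orbT => /(_ isT)/eqP Ey.
  by rewrite Ev Ey eirr in evy.
rewrite /=; apply/norP; split.
  by apply/existsP=> -[v]; have := nw v _ (sub0set _) => /existsP + sv;
    case; exists v.
apply/existsP=> -[x /andP[_]]; rewrite /dominator_turn setU0 (nw x) //=.
by case/andP=> /set0Pn[y yF] /forall_inP/(_ y yF).
Qed.

(** As [2 < #|T|], the minimum is not the default value. *)
Lemma t_p_le1P (PP : {set vseq T}) : 2 < #|T| -> t_p PP <= 1 ->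
  exists2 U : {set T}, transversal_of PP U & #|U| <= 1.
Proof.
move=> T3; rewrite /t_p; have [->|[U tU ->]] := bigminn_attained
  (fun U : {set T} => transversal_of PP U) (fun U => #|U|) #|T|; first by lia.
by exists U.
Qed.

Variables (w0 : T) (W' : seq T).
Local Notation W := (w0 :: W').
Hypotheses (uW : uniq W) (sW : sorted e W) (cvW : covers_edges e W).
Local Notation sup := (is_support e W).
Hypotheses (sup0 : sup w0) (supl : sup (last w0 W')).

Lemma gap_path s1 l acc v s2 : W = s1 ++ l :: acc ++ v :: s2 ->
  sup l -> sup v -> all (predC sup) acc -> odd (size acc) ->
  exists a b, [/\ a \notin W, b \notin W, e l a, e v b &
    exists2 P, P \in C & P = a :: l :: acc ++ [:: v; b] :> seq T].
Proof.
move=> defW /existsP[a /andP[aW ela]] /existsP[b /andP[bW evb]] nsa oda.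
exists a, b; split=> //.
exact: (clean_odd_gap esym eirr acyclic uW sW cvW defW).
Qed.

Lemma staller_first_bound n : (forall P, P \in C -> 2 ^ n < size P) ->
  ~~ forces n set0 set0.
Proof.
move=> long; have [n1|n2] := leqP n 1; first exact: forces_small.
(* Hence no clean odd path has three vertices, and no spine vertex has two leaves. *)
have e4 : 4 <= 2 ^ n by rewrite -[4]/(2 ^ 2) leq_exp2l.
apply: (spine_holds esym acyclic has_nbr uW sW cvW sup0 supl) => //.
- exact: ltnW.
- by move=> u; rewrite inE.
- move=> w a b wW _ aW bW ewa ewb; apply/eqP/negPn/negP=> ab.
  have [P /long + defP] :=
    clean_odd_star esym acyclic uW sW cvW wW aW bW ab ewa ewb.
  by rewrite defP ltnNge ltnW.
- move=> s1 l acc v s2 defW sl sv nsa oda _ _.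
  have [a [b [_ _ _ _ [P /long + defP]]]] := gap_path defW sl sv nsa oda.
  by rewrite defP /= size_cat /=; lia.
Qed.

(* A vertex hitting all short clean odd paths can be moved to a support vertex
   of the spine without missing any of them. *)
Lemma support_transversal n (U : {set T}) : 1 < n ->
  transversal_of [set P in C | size P <= 2 ^ n] U -> #|U| <= 1 ->
  exists u, [/\ u \in W, sup u,
    forall w a b, w \in W -> a \notin W -> b \notin W -> a != b ->
      e w a -> e w b -> w = u
    & forall s1 l acc v s2, W = s1 ++ l :: acc ++ v :: s2 -> sup l -> sup v ->
      all (predC sup) acc -> odd (size acc) -> size acc + 4 <= 2 ^ n ->
      l = u \/ v = u].
Proof.
move=> n2 /forall_inP tU U1.
have e4 : 4 <= 2 ^ n by rewrite -[4]/(2 ^ 2) leq_exp2l.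
have hitU P : P \in C -> size P <= 2 ^ n -> exists2 z, z \in (P : seq T) & z \in U.
  by move=> PC sP; apply/hasP; apply: tU; rewrite inE PC.
have hstar w a b : w \in W -> a \notin W -> b \notin W -> a != b ->
    e w a -> e w b -> exists2 z, z \in [:: a; w; b] & z \in U.
  move=> wW aW bW ab ewa ewb.
  have [P PC defP] := clean_odd_star esym acyclic uW sW cvW wW aW bW ab ewa ewb.
  by rewrite -defP; apply: hitU => //; rewrite defP ltnW.
have hgap s1 l acc v s2 : W = s1 ++ l :: acc ++ v :: s2 -> sup l -> sup v ->
    all (predC sup) acc -> odd (size acc) -> size acc + 4 <= 2 ^ n ->
    exists a b, [/\ a \notin W, b \notin W, e l a, e v b &
      exists2 z, z \in a :: l :: acc ++ [:: v; b] & z \in U].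
  move=> defW sl sv nsa oda short.
  have [a [b [aW bW ela evb [P PC defP]]]] := gap_path defW sl sv nsa oda.
  exists a, b; split=> //; rewrite -defP; apply: hitU => //.
  by rewrite defP /= size_cat /=; move: short; clear; lia.
have [U0|[u' u'U]] := set_0Vmem U.
  exists w0; split=> //; first exact: mem_head.
    by move=> w a b wW aW bW ab ewa ewb;
       have [z _] := hstar w a b wW aW bW ab ewa ewb;
       rewrite U0 inE.
  move=> s1 l acc v s2 defW sl sv nsa oda short.
  by have [a [b [_ _ _ _ [z _]]]] := hgap _ _ _ _ _ defW sl sv nsa oda short;
     rewrite U0 inE.
have inU z : z \in U -> z = u'.
  by move=> zU; apply: (card_le1_eqP U1).
have supI w a : a \notin W -> e w a -> sup w.
  by move=> aW ewa; apply/existsP; exists a; rewrite aW.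
have gapW s1 l acc v s2 : W = s1 ++ l :: acc ++ v :: s2 ->
    [/\ l \in W, v \in W & {subset acc <= W}].
  move=> ->; split=> [||z zacc];
  by rewrite !(mem_cat, inE) ?eqxx ?zacc ?orbT.
(* A leaf [u'] is replaced by its only neighbor, which lies on every path considered here that
   contains [u']. *)
have [u'W|u'W] := boolP (u' \in W); last first.
  have [w euw] := has_nbr u'; have wW := off_nbr_mem cvW u'W euw.
  have uq w' : e w' u' -> w' = w.
    by move=> ew'; apply: (off_nbr_uniq esym acyclic uW sW cvW u'W); rewrite // esym.
  exists w; split=> //; first by apply: (supI w u'); rewrite // esym.
    move=> w' a b w'W aW bW ab ewa ewb.
    have [z + /inU E] := hstar w' a b w'W aW bW ab ewa ewb; rewrite {z}E.
    rewrite !inE => /or3P[]/eqP E; rewrite E in u'W uq *.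
    - exact: uq.
    - by rewrite w'W in u'W.
    - exact: uq.
  move=> s1 l acc v s2 defW sl sv nsa oda short.
  have [a [b [aW bW ela evb [z + /inU E]]]] :=
    hgap _ _ _ _ _ defW sl sv nsa oda short.
  have [lW vW accW] := gapW _ _ _ _ _ defW.
  rewrite {z}E !inE mem_cat !inE => /or4P[/eqP E|/eqP E|/accW E|/orP[]/eqP E].
  - by left; apply: uq; rewrite E.
  - by rewrite E lW in u'W.
  - by rewrite E in u'W.
  - by rewrite E vW in u'W.
  - by right; apply: uq; rewrite E.
have nu' a : a \notin W -> u' != a by apply: contraNneq => <-.
have [su'|nsu'] := boolP (sup u').
  exists u'; split=> // [w a b wW aW bW ab ewa ewb|].
    have [z + /inU E] := hstar w a b wW aW bW ab ewa ewb.
    by rewrite {z}E !inE (negPf (nu' a aW)) (negPf (nu' b bW)) orbF => /eqP.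
  move=> s1 l acc v s2 defW sl sv nsa oda short.
  have [a [b [aW bW ela evb [z + /inU E]]]] :=
    hgap _ _ _ _ _ defW sl sv nsa oda short.
  rewrite {z}E !inE mem_cat !inE => /or4P[/eqP E|/eqP E|/(allP nsa)|/orP[]/eqP E].
  - by rewrite E (negPf aW) in u'W.
  - by left.
  - by rewrite /= su'.
  - by right.
  - by rewrite E (negPf bW) in u'W.
have [t1 [t2 defW']] : exists t1 t2, W = t1 ++ u' :: t2.
  by case/splitPr: u'W => t1 t2; exists t1, t2.
have u't1 : u' \notin t1.
  by move: uW; rewrite defW' cat_uniq => /and3P[_ /norP[]].
have t1W z : z \in t1 -> z \in W by rewrite defW' mem_cat => ->.
(* A spine vertex [u'] that is no support vertex lies inside at most one gap, whose left end is the
   last support vertex before [u']. *)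
pose u := last w0 (filter sup t1).
have [uinW su] : u \in W /\ sup u.
  have := mem_last w0 (filter sup t1); rewrite -/u inE => /orP[/eqP->|].
    by rewrite mem_head.
  by rewrite mem_filter => /andP[su /t1W].
exists u; split=> // [w a b wW aW bW ab ewa ewb|].
  have [z + /inU E] := hstar w a b wW aW bW ab ewa ewb.
  rewrite {z}E !inE (negPf (nu' a aW)) (negPf (nu' b bW)) orbF => /eqP E.
  by rewrite E (supI w a) in nsu'.
move=> s1 l acc v s2 defW sl sv nsa oda short.
have [a [b [aW bW ela evb [z + /inU E]]]] :=
    hgap _ _ _ _ _ defW sl sv nsa oda short.
rewrite {z}E !inE mem_cat !inE => /or4P[/eqP E|/eqP E|u'acc|/orP[]/eqP E].
- by rewrite E (negPf aW) in u'W.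
- by rewrite E sl in nsu'.
- left; case/splitPr: u'acc defW nsa {oda short} => a1 a2 defW nsa.
  have Et : t1 = s1 ++ l :: a1.
    have := defW; rewrite defW' -catA -cat_cons catA => /eqP.
    by rewrite uniq_eqseq_pivotl -?defW' // => /andP[/eqP].
  rewrite /u Et filter_cat /= sl last_cat /=.
  move: nsa; rewrite all_cat => /andP[nsa1 _].
  suff -> : filter sup a1 = [::] by [].
  by elim: (a1) nsa1 => //= c a3 IH /andP[/negPf-> /IH].
- by rewrite E sv in nsu'.
- by rewrite E (negPf bW) in u'W.
Qed.

(** Dominator opens at the vertex [u] of [support_transversal]: all short gaps end at [u], and only
    [u] can have two leaves. *)
Lemma dominator_first_bound n : 2 < #|T| ->
  t_p [set P in C | size P <= 2 ^ n] <= 1 ->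
  ~~ dominator_turn e (fun D => forces n D set0) set0 set0.
Proof.
move=> T3 tp.
suff [u hu] : exists u, ~~ forces n [set u] set0.
  have nw : ~~ staller_won e set0.
    apply: contra hu => w; case: (n) => [|k] /=; by rewrite w.
  rewrite /dominator_turn (negPf nw) /=; apply/negP=> /andP[_ /forall_inP/(_ u)].
  by rewrite !inE setU0 (negPf hu) => /(_ isT).
have [n1|n2] := leqP n 1; first by exists w0; apply: forces_small.
have [U tU U1] := t_p_le1P T3 tp.
have [u [uinW su h1 h2]] := support_transversal n2 tU U1.
exists u; apply: (spine_holds esym acyclic has_nbr uW sW cvW sup0 supl) => //.
- exact: ltnW.
- by move=> u'; rewrite inE => /eqP->; rewrite uinW.
- move=> w a b wW; rewrite inE => wu aW bW ewa ewb; apply/eqP/negPn/negP=> ab.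
  by rewrite (h1 w a b) ?eqxx in wu.
- move=> s1 l acc v s2 defW sl sv nsa oda; rewrite !inE => lu vu.
  rewrite ltnNge; apply/negP=> /(h2 _ _ _ _ _ defW sl sv nsa oda)[]E.
    by rewrite E eqxx in lu.
  by rewrite E eqxx in vu.
Qed.

End Caterpillar.

(* up_log 2 m is the ceiling of log_2 m, and None stands for infinity. *)
Theorem theorem24 (T : finType) (e : rel T) :
  simple_graph e -> is_caterpillar e ->
  gamma_SMB' e =
    (if clean_odd_maximal_paths e == set0 then None
     else Some (up_log 2 (p_min e)))
  /\
  gamma_SMB e =
    (if t_p (clean_odd_maximal_paths e) <= 1 then None
     else Some (up_log 2 (p_star e))).
Proof.
move=> [esym eirr] [[_ conn acyclic] T3 [P0 P0p cov0]].
set C := clean_odd_maximal_paths e.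
have has_nbr x : exists y, e x y.
  have [y yx] : exists y, y != x.
    have : 0 < #|[set~ x]| by rewrite cardsC1; lia.
    by case/card_gt0P=> y; rewrite !inE; exists y.
  case/connectP: (conn x y) => -[|z p] /=; first by move=> _ E; rewrite E eqxx in yx.
  by case/andP=> exz _ _; exists z.
have [w0 [W' [uW sW cvW sup0 supl]]] : exists w W,
    [/\ uniq (w :: W), sorted e (w :: W), covers_edges e (w :: W),
        is_support e (w :: W) w & is_support e (w :: W) (last w W)].
  move: P0p; rewrite in_paths => /and3P[P0n P0s P0u].
  apply: (trim_spine esym eirr acyclic has_nbr P0n P0u P0s) => x y exy.
  case: (cov0 x y exy) => [->|->|h]; rewrite ?orbT //.
  by rewrite (mem_edges h) // !inE eqxx.
have boundS := staller_first_bound esym eirr acyclic has_nbr uW sW cvW sup0 supl.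
have boundD n := @dominator_first_bound _ _ esym eirr acyclic has_nbr
  _ _ uW sW cvW sup0 supl n T3.
have sizeT (P : vseq T) : size P <= #|T| by apply: size_bseq.
(* [min_moves] searches only up to [#|T|], so the claimed values must lie in that range. *)
have up_log_le k : k <= #|T| -> up_log 2 k <= #|T|.
  move=> kT; apply: leq_trans kT.
  by apply: up_log_min => //; apply/ltnW/ltn_expl.
have lt_up_log k n : n < up_log 2 k -> 2 ^ n < k.
  by move=> h; rewrite ltnNge; apply: contraL h => h; rewrite -leqNgt up_log_min.
split.
  have [C0|[P1 P1C]] := set_0Vmem C.
    rewrite C0 eqxx; apply: min_moves_None => n; apply: boundS => P.
    by rewrite -/C C0 inE.
  have -> : (C == set0) = false by apply/negbTE/set0Pn; exists P1.
  have [P2 P2C pE] : exists2 P, P \in C & p_min e = size P.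
    have := bigminn_leq (fun P : vseq T => size P) #|T| P1C.
    rewrite -/(p_min e) => le1.
    (* If the minimum is the default [#|T|], then [P1] attains it, as no path has more vertices. *)
    have [E|//] := bigminn_attained
      (fun P => P \in C) (fun P : vseq T => size P) #|T|.
    exists P1 => //; apply/eqP; rewrite eqn_leq le1 /=.
    by rewrite /p_min E.
  apply: min_moves_Some.
  - by rewrite pE up_log_le.
  - rewrite pE; apply: (clean_odd_forces esym eirr acyclic has_nbr P2C) => z.
    by rewrite inE.
  - move=> n /lt_up_log ltn; apply: boundS => P PC; apply: leq_trans ltn _.
    exact: bigminn_leq.
have tp_mono (A B : {set vseq T}) : A \subset B -> t_p A <= t_p B.
  move=> sAB; rewrite {2}/t_p; have [->|[U tU ->]] := bigminn_attained
    (fun U : {set T} => transversal_of B U) (fun U => #|U|) #|T|.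
    exact: bigminn_leq_default.
  apply: bigminn_leq; apply/forall_inP=> P PA.
  by move/forall_inP: tU; apply; apply: (subsetP sAB).
case: leqP => [tp1|tp2].
  apply: min_moves_None => n; apply: boundD; apply: leq_trans tp1.
  by apply: tp_mono; apply/subsetP=> P; rewrite !inE => /andP[].
pose short s := [set P in C | size P <= s].
have shortT : short #|T| = C.
  by apply/setP=> P; rewrite inE sizeT andbT.
have [s sT [tps pE]] : exists2 s, s <= #|T| & 2 <= t_p (short s) /\ p_star e = s.
  have := bigminn_attained (fun s : 'I_#|T|.+1 => 2 <= t_p (short s))
    (fun s => nat_of_ord s) #|T|.
  case=> [E|[s tps E]]; first by exists #|T|; rewrite ?shortT.
  by exists s; [rewrite -ltnS|].
apply: min_moves_Some.
- by rewrite pE up_log_le.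
- apply/orP; right; apply/andP; split.
    by apply/set0Pn; exists w0; rewrite !inE.
  apply/forall_inP=> y _; rewrite setU0.
  (* Dominator's first move [y] alone is no transversal of the short paths, so Staller can play on
     one that avoids it. *)
  have [P PC yP] : exists2 P, P \in short s & y \notin (P : seq T).
    apply/exists_inP; apply: contraLR tps => /exists_inPn h.
    rewrite -leqNgt -(cards1 y); apply: bigminn_leq.
    apply/forall_inP=> P /h; rewrite negbK => yP.
    by apply/hasP; exists y; rewrite ?inE.
  move: PC; rewrite inE => /andP[PC sP].
  apply: (@forces_leq _ _ (up_log 2 (size P))); first by rewrite pE leq_up_log.
  apply: (clean_odd_forces esym eirr acyclic has_nbr PC) => z zP.
  by rewrite inE; apply: contraNneq yP => <-.
- move=> n /lt_up_log ltn; apply: boundD; rewrite leqNgt; apply/negP=> tpn.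
  have ltT : 2 ^ n < #|T|.+1
    by rewrite ltnS; apply: leq_trans (ltnW ltn) _; rewrite pE.
  have := @bigminn_leq _ (fun s : 'I_#|T|.+1 => 2 <= t_p (short s))
    (fun s => nat_of_ord s) #|T| (Ordinal ltT) tpn.
  by rewrite leqNgt /= ltn.
Qed.
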